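(* There exist absolute constants $c>0$ and $d_0\in\mathbb{N}$ such that for all integers $d\geq d_0$, $$\sigma(\mathbb{B}^d(0,1))\leq \frac{1}{2}+\exp(-cd).$$
   Context: $\mathbb{B}^d(0,1)$ denotes the Euclidean unit ball in $\mathbb{R}^d$ centred at the origin. A subset $S\subset\mathbb{R}^d$ is sum-free if there are no $a,b,c\in S$ (not necessarily distinct) with $a+b=c$. For a bounded convex region $R\subset\mathbb{R}^d$ with nonempty interior, let $\mu_R$ be the uniform probability measure on $R$, i.e. $\mu_R(S)=\lambda(S\cap R)/\lambda(R)$, where $\lambda$ is the $d$-dimensional Lebesgue measure. Define $$\sigma(R)=\sup\{\mu_R(S) : S\subset\mathbb{R}^d \text{ is Borel and sum-free}\}.$$ *)

(* Defs.v *)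
From HB Require Import structures.
From mathcomp Require Import all_boot all_order all_algebra.
From mathcomp Require Import all_classical all_reals all_analysis.
From mathcomp Require Import measurable_realfun.

Set Implicit Arguments.
Unset Strict Implicit.
Unset Printing Implicit Defensive.
Set SsrOldRewriteGoalsOrder.

Import Order.TTheory GRing.Theory Num.Theory.
Import numFieldNormedType.Exports.

Local Open Scope classical_set_scope.
Local Open Scope ring_scope.

(* ['rV[R]_d] has a library topology but no measurable structure; this is
   ['rV[R]_d] equipped with its Borel sigma-algebra. *)
Notation rVborel R d := (g_sigma_algebraType (@open 'rV[R]_d)).

Section BorelVectors.
Context {R : realType}.

Lemma measurable_rV_coord (d : nat) (i : 'I_d) :
  measurable_fun [set: rVborel R d]
    (fun v : rVborel R d => (v : 'rV[R]_d) ord0 i : measurableTypeR R).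
Proof.
apply: (measurability _ (RGenOpens.measurableE R)) => _ [_ [a [b ->]] <-].
rewrite setTI; apply: sub_sigma_algebra.
move/continuousP: (@coord_continuous R 1 d ord0 i); apply.
exact: interval_open.
Qed.

Lemma measurable_fun_rV (e : measure_display) (T : measurableType e) (d : nat)
    (f : T -> rVborel R d) :
  (forall i, measurable_fun [set: T]
     (fun x => (f x : 'rV[R]_d) ord0 i : measurableTypeR R)) ->
  measurable_fun [set: T] f.
Proof.
move=> mf.
apply: (@measurability _ _ _ _ _ f (@open 'rV[R]_d)) => // _ [U oU <-].
rewrite setTI.
pose B (p : 'rV[rat]_d * nat) : set 'rV[R]_d :=
  [set v | forall i, ball (ratr (p.1 ord0 i) : R) p.2.+1%:R^-1 (v ord0 i)].
have -> : f @^-1` U = \bigcup_(p in [set p | B p `<=` U]) (f @^-1` B p).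
  apply/seteqP; split=> [x Ux|x [p /= pU]]; last exact: pU.
  have /nbhs_ballP[e0 /= e0_gt0 eU] : nbhs (f x : 'rV[R]_d) U.
    by apply: open_nbhs_nbhs; split.
  have [k ke] : exists k : nat, k.+1%:R^-1 < e0 / 2.
    have /ltr_add_invr[k] : 0 < e0 / 2 by rewrite divr_gt0.
    by rewrite add0r; exists k.
  have q_ i : exists q : rat,
      ball (ratr q : R) k.+1%:R^-1 ((f x : 'rV[R]_d) ord0 i).
    have /rat_in_itvoo[q] : (f x : 'rV[R]_d) ord0 i <
        (f x : 'rV[R]_d) ord0 i + k.+1%:R^-1 by rewrite ltrDl.
    rewrite in_itv/= => /andP[q1 q2]; exists q.
    by rewrite /ball/= gtr0_norm ?subr_gt0// ltrBlDl.
  pose q := fun i => sval (cid (q_ i)).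
  exists (\row_i q i, k) => /=; last first.
    by move=> i; rewrite mxE; exact: (svalP (cid (q_ i))).
  move=> v Bv; apply: eU; split => // i j; rewrite (ord1 i).
  apply: (@ball_splitr R R (ratr (q j))).
    apply: le_ball (svalP (cid (q_ j))); exact: ltW.
  by apply: le_ball (ltW ke) _ _; have := Bv j; rewrite /= mxE.
rewrite bigcup_mkcond; apply: countable_bigcupT_measurable => // p.
case: ifPn => // _.
have -> : f @^-1` B p = \bigcap_(i in [set: 'I_d])
    ((fun x => (f x : 'rV[R]_d) ord0 i) @^-1`
      ball (ratr (p.1 ord0 i) : R) p.2.+1%:R^-1).
  by apply/seteqP; split=> x /=; [move=> h i _; exact: h|move=> h i; exact: h].
apply: fin_bigcap_measurable => // i _.
by rewrite -[X in measurable X]setTI; apply: mf => //; exact: measurable_ball.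
Qed.

Definition rV_cons (d : nat) (p : measurableTypeR R * rVborel R d) :
  rVborel R d.+1 :=
  row_mx (const_mx (p.1 : R) : 'rV[R]_1) (p.2 : 'rV[R]_d).

Definition rV_uncons (d : nat) (v : rVborel R d.+1) :
  measurableTypeR R * rVborel R d :=
  (lsubmx (v : 'rV[R]_(1 + d)) ord0 ord0, rsubmx (v : 'rV[R]_(1 + d))).

Lemma rV_consK (d : nat) : cancel (@rV_cons d) (@rV_uncons d).
Proof.
by case=> x v; rewrite /rV_uncons /rV_cons row_mxKl row_mxKr mxE.
Qed.

Lemma rV_cons_ord0 (d : nat) (p : measurableTypeR R * rVborel R d) :
  (rV_cons p : 'rV[R]_d.+1) ord0 ord0 = p.1.
Proof.
have -> : ord0 = lshift d ord0 :> 'I_(1 + d) by exact: val_inj.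
by rewrite /rV_cons (@row_mxEl _ 1 1 d) mxE.
Qed.

Lemma rV_cons_lift (d : nat) (p : measurableTypeR R * rVborel R d) (i : 'I_d) :
  (rV_cons p : 'rV[R]_d.+1) ord0 (lift ord0 i) = (p.2 : 'rV[R]_d) ord0 i.
Proof.
have -> : lift ord0 i = rshift 1 i :> 'I_(1 + d) by exact: val_inj.
by rewrite /rV_cons (@row_mxEr _ 1 1 d).
Qed.

Lemma measurable_rV_cons (d : nat) : measurable_fun setT (@rV_cons d).
Proof.
apply: measurable_fun_rV => i; have [j ->|->] := unliftP ord0 i.
  apply: (eq_measurable_fun
    ((fun v : rVborel R d => (v : 'rV[R]_d) ord0 j : measurableTypeR R) \o snd)).
    by move=> p _; rewrite rV_cons_lift.
  by apply: measurableT_comp => //; exact: measurable_rV_coord.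
by apply: (eq_measurable_fun fst) => // p _; rewrite rV_cons_ord0.
Qed.

Lemma measurable_rV_uncons (d : nat) : measurable_fun setT (@rV_uncons d).
Proof.
apply/measurable_fun_pairP; split.
  apply: (eq_measurable_fun (fun v : rVborel R d.+1 =>
    (v : 'rV[R]_(1 + d)) ord0 (lshift d ord0) : measurableTypeR R)).
    by move=> v _; rewrite /= mxE.
  exact: measurable_rV_coord.
apply: measurable_fun_rV => i.
apply: (eq_measurable_fun (fun v : rVborel R d.+1 =>
  (v : 'rV[R]_(1 + d)) ord0 (rshift 1 i) : measurableTypeR R)).
  by move=> v _; rewrite /= mxE.
exact: measurable_rV_coord.
Qed.

End BorelVectors.

Section LebesgueCons.
Context {R : realType} {d : nat}.
Variable m : {sigma_finite_measure set (rVborel R d) -> \bar R}.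

Definition lebesgue_cons : set (rVborel R d.+1) -> \bar R :=
  pushforward ((@lebesgue_measure R) \x m)%E (@rV_cons R d).

Let lebesgue_cons0 : lebesgue_cons set0 = 0%E.
Proof. by rewrite /lebesgue_cons /pushforward preimage_set0 measure0. Qed.

Let lebesgue_cons_ge0 A : (0 <= lebesgue_cons A)%E.
Proof. by rewrite /lebesgue_cons /pushforward; exact: measure_ge0. Qed.

Let lebesgue_cons_sigma_additive : semi_sigma_additive lebesgue_cons.
Proof.
have mcons A : measurable A -> measurable (@rV_cons R d @^-1` A).
  by move=> mA; rewrite -[X in measurable X]setTI; exact: measurable_rV_cons.
move=> F mF tF mUF; rewrite /lebesgue_cons /pushforward preimage_bigcup.
apply: measure_semi_sigma_additive.
- by move=> n; exact: mcons.
- apply/trivIsetP => /= i j _ _ ij; rewrite -preimage_setI.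
  by move/trivIsetP : tF => /(_ _ _ _ _ ij) ->//; rewrite preimage_set0.
- by rewrite -preimage_bigcup; exact: mcons.
Qed.

HB.instance Definition _ := isMeasure.Build _ _ _ lebesgue_cons
  lebesgue_cons0 lebesgue_cons_ge0 lebesgue_cons_sigma_additive.

Let lebesgue_cons_sigma_finite : sigma_finite setT lebesgue_cons.
Proof.
have /sigma_finiteP[F [TF ndF Foo]] := sigma_finiteT (@lebesgue_measure R).
have /sigma_finiteP[G [TG ndG Goo]] := sigma_finiteT m.
exists (fun n => @rV_uncons R d @^-1` (F n `*` G n)).
  rewrite -preimage_bigcup -(preimage_setT (@rV_uncons R d)) -setXTT TF TG.
  congr (_ @^-1` _); apply/seteqP; split=> -[x v] /=.
  - move=> [[n _ Fnx] [k _ Gkv]]; exists (maxn n k) => //; split.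
    + by move: x Fnx; exact/subsetPset/ndF/leq_maxl.
    + by move: v Gkv; exact/subsetPset/ndG/leq_maxr.
  - by move=> [n _ [/= ? ?]]; split; exists n.
move=> n; have [mF Fn] := Foo n; have [mG Gn] := Goo n; split.
  rewrite -[X in measurable X]setTI; apply: measurable_rV_uncons => //.
  exact: measurableX.
rewrite /lebesgue_cons /pushforward -comp_preimage.
rewrite (_ : _ \o _ = id) ?preimage_id; last first.
  by apply/funext => p; exact: rV_consK.
by rewrite product_measure1E// lte_mul_pinfty// ge0_fin_numE.
Qed.

HB.instance Definition _ := Measure_isSigmaFinite.Build _ _ _ lebesgue_cons
  lebesgue_cons_sigma_finite.

End LebesgueCons.

(* Lebesgue measure on ['rV[R]_d] as the [d]-fold product of the
   one-dimensional one; see [lebesgue_rV_box]. *)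
Fixpoint lebesgue_rV (R : realType) (d : nat) :
    {sigma_finite_measure set (rVborel R d) -> \bar R} :=
  match d with
  | 0 => @dirac _ (rVborel R 0) (0 : 'rV[R]_0) R
  | d'.+1 => lebesgue_cons (lebesgue_rV R d')
  end.

Lemma lebesgue_rV_box (R : realType) (d : nat) (A : 'I_d -> set R) :
  (forall i, measurable (A i : set (measurableTypeR R))) ->
  lebesgue_rV R d [set v : 'rV[R]_d | forall i, A i (v ord0 i)] =
  (\prod_(i < d) lebesgue_measure (A i))%E.
Proof.
elim: d A => [|d IH] A mA.
  by rewrite big_ord0 /= diracE mem_set// => -[].
rewrite big_ord_recl -IH//= /lebesgue_cons /pushforward.
rewrite -product_measure1E//; last first.
  rewrite (_ : [set _ | _] = \bigcap_(i in [set: 'I_d])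
      ((fun v : rVborel R d => (v : 'rV[R]_d) ord0 i) @^-1` A (lift ord0 i))).
    apply: fin_bigcap_measurable => // i _.
    by rewrite -[X in measurable X]setTI; exact: measurable_rV_coord.
  by apply/seteqP; split=> v /=; [move=> h i _; exact: h|move=> h i; exact: h].
congr product_measure1; apply/seteqP; split=> -[x v] /=.
- move=> h; split=> [|i]; first by have := h ord0; rewrite rV_cons_ord0.
  by have := h (lift ord0 i); rewrite rV_cons_lift.
- move=> [Ax Av] i; have [j ->|->] := unliftP ord0 i.
    by rewrite rV_cons_lift; exact: Av.
  by rewrite rV_cons_ord0.
Qed.

Section SumFree.
Context {R : realType} {d : nat}.
Implicit Types S B : set 'rV[R]_d.

Definition euclidean_norm (x : 'rV[R]_d) : R :=
  Num.sqrt (\sum_(i < d) x ord0 i ^+ 2).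

Definition closed_euclidean_ball (x : 'rV[R]_d) (r : R) : set 'rV[R]_d :=
  [set y | euclidean_norm (y - x) <= r].

Definition sum_free S :=
  ~ exists a b c, [/\ S a, S b, S c & a + b = c].

Definition borel S := measurable (S : set (rVborel R d)).

(* Intended for [B] a bounded convex region with nonempty interior, so that
   the denominator is positive and finite. *)
Definition uniform_measure B S : \bar R :=
  (lebesgue_rV R d (S `&` B) / lebesgue_rV R d B)%E.

Definition sigma B : \bar R :=
  ereal_sup [set uniform_measure B S | S in [set S | borel S /\ sum_free S]].

End SumFree.

(* Main.v *)
(* A Fourier argument on a randomly rotated discrete cube. Take [m = 16 p <= d]
   and embed the vectors with entries [±1/sqrt m] isometrically in R^d by
   [|x| O], where [x] is uniform in the ball and [O] is a random rotation; each
   image is then uniform in the ball. If [v], [w] are cube vectors at Hamming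
   distance [4 p], then [<v, w> = 1/2], so [v], [w - v] and [w] have the same
   length and [v] is as likely to be hit by the sum-free set [S] together with
   [w - v] as it is together with [-w] (reflect the plane of [v], [w]). Since
   [S] cannot contain the images of [v], [w - v] and [w] at once,
     [P(v, w in S) + P(v, -w in S) <= mu(S)].
   The eigenvalues of the average over such pairs are normalised Krawtchouk
   values. On even characters they are nonnegative at low (hence, by symmetry,
   at high) weight, and exponentially small in between because of their
   multiplicity. So the left-hand side is at least [2 mu(S)^2] up to an
   exponentially small error, and [mu(S) <= 1/2 + exp(-c d)]. *)

Require Import Defs.
From mathcomp Require Import all_boot all_order all_algebra.
From mathcomp Require Import all_classical all_reals all_analysis.
From mathcomp Require Import measurable_realfun ring lra zify.

Set Implicit Arguments.
Unset Strict Implicit.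
Unset Printing Implicit Defensive.
Set SsrOldRewriteGoalsOrder.

Import Order.TTheory GRing.Theory Num.Theory.
Import numFieldNormedType.Exports.

Local Open Scope classical_set_scope.
Local Open Scope ring_scope.

(** * The Hamming cube *)

Section HammingCube.
Context {R : realFieldType} {m : nat}.

Notation cube := {ffun 'I_m -> bool}.
Implicit Types A B D T : cube.

Definition weight A : nat := \sum_i A i.
Definition cube_add A B : cube := [ffun i => A i (+) B i].
(** The antipode, that is negation of the sign vector; it is not the inverse for [cube_add], where
    every point is its own inverse. *)
Definition cube_opp A : cube := [ffun i => ~~ A i].
Definition character T A : R := \prod_i (-1) ^+ (T i && A i).

Lemma cube_addK D : involutive (cube_add^~ D).
Proof. by move=> A; apply/ffunP => i; rewrite !ffunE addbK. Qed.

Lemma cube_oppK : involutive cube_opp.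
Proof. by move=> A; apply/ffunP => i; rewrite !ffunE negbK. Qed.

Lemma weight_le A : (weight A <= m)%N.
Proof.
rewrite -[X in (_ <= X)%N]card_ord -sum1_card; apply: leq_sum => i _.
exact: leq_b1.
Qed.

Lemma weight_opp A : weight (cube_opp A) = (m - weight A)%N.
Proof.
have : (weight (cube_opp A) + weight A = m)%N.
  rewrite /weight -big_split /= -[RHS]card_ord -sum1_card.
  by apply: eq_bigr => i _; rewrite ffunE; case: (A i).
by move=> <-; rewrite addnK.
Qed.

Lemma characterC T A : character T A = character A T.
Proof. by apply: eq_bigr => i _; rewrite andbC. Qed.

Lemma character_add T A B :
  character T (cube_add A B) = character T A * character T B.
Proof.
rewrite -big_split; apply: eq_bigr => i _ /=; rewrite ffunE.
by case: (T i) (A i) (B i) => [] [] []; rewrite /= ?expr0 ?expr1; ring.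
Qed.

Lemma character_opp T A :
  character T (cube_opp A) = (-1) ^+ weight T * character T A.
Proof.
rewrite -prodrXr -big_split; apply: eq_bigr => i _ /=; rewrite ffunE.
by case: (T i) (A i) => [] []; rewrite /= ?expr0 ?expr1; ring.
Qed.

Lemma character0 A : character [ffun=> false] A = 1.
Proof. by rewrite /character big1// => i _; rewrite ffunE. Qed.

Lemma sum_character A B :
  \sum_T character T A * character T B = (2 ^ m)%:R * (A == B)%:R.
Proof.
transitivity (\sum_T character T (cube_add A B)).
  by apply: eq_bigr => T _; rewrite character_add.
rewrite -(bigA_distr_bigA (fun i (b : bool) => (-1) ^+ (b && cube_add A B i))).
under eq_bigr do rewrite big_bool /= expr0 ffunE.
case: eqVneq => [->|AB].
  under eq_bigr do rewrite addbb expr0.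
  by rewrite prodr_const card_ord mulr1 natrX.
have [i iAB] : exists i, A i != B i.
  apply/existsP; apply: contraNT AB; rewrite negb_exists => /forallP AB.
  by apply/eqP/ffunP => i; apply/eqP; have := AB i; rewrite negbK.
rewrite (bigD1 i)//= (_ : A i (+) B i); last by case: (A i) (B i) iAB => [] [].
by rewrite expr1 addNr mul0r mulr0.
Qed.

(** The Walsh transform without normalisation, hence the factor [2 ^ m] in [parseval]. *)
Definition fourier (F : cube -> R) T : R := \sum_A F A * character T A.

Lemma parseval (F G : cube -> R) :
  \sum_T fourier F T * fourier G T = (2 ^ m)%:R * \sum_A F A * G A.
Proof.
transitivity (\sum_T \sum_A \sum_B F A * G B * (character T A * character T B)).
  apply: eq_bigr => T _; rewrite mulr_suml; apply: eq_bigr => A _.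
  by rewrite mulr_sumr; apply: eq_bigr => B _; rewrite mulrACA.
rewrite exchange_big mulr_sumr; apply: eq_bigr => A _ /=.
rewrite exchange_big (bigD1 A)//= [X in _ + X]big1 ?addr0 => [|B BA].
  by rewrite -mulr_sumr sum_character eqxx mulr1 mulrC.
by rewrite -mulr_sumr sum_character eq_sym (negbTE BA) !mulr0.
Qed.

(** The eigenvalue, at the character [T], of summation over the Hamming sphere of radius [k]. *)
Definition krawtchouk k T : R := \sum_(D | weight D == k) character T D.

Lemma fourier_shell k T :
  fourier (fun D => (weight D == k)%:R) T = krawtchouk k T.
Proof.
rewrite /fourier /krawtchouk [RHS]big_mkcond; apply: eq_bigr => D _.
by case: eqP; rewrite ?mul1r ?mul0r.
Qed.

Lemma fourier_convolution k (G : cube -> R) T :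
  fourier (fun A => \sum_(D | weight D == k) G (cube_add A D)) T =
  krawtchouk k T * fourier G T.
Proof.
rewrite /fourier /krawtchouk mulr_suml; under eq_bigr do rewrite mulr_suml.
rewrite exchange_big; apply: eq_bigr => D _ /=.
rewrite mulr_sumr (reindex_inj (can_inj (cube_addK D)))/=.
by apply: eq_bigr => A _; rewrite character_add cube_addK; ring.
Qed.

(** The antipode multiplies a character by the parity sign of its weight, so symmetrising doubles
    the even characters and kills the odd ones. *)
Lemma fourier_even (F : cube -> R) T :
  fourier (fun A => F A + F (cube_opp A)) T = (1 + (-1) ^+ weight T) * fourier F T.
Proof.
rewrite /fourier mulrDl mul1r; under eq_bigr do rewrite mulrDl.
rewrite big_split/=; congr (_ + _); rewrite mulr_sumr.
rewrite (reindex_inj (can_inj cube_oppK)); apply: eq_bigr => A _ /=.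
by rewrite cube_oppK character_opp; ring.
Qed.

Lemma parseval_convolution k (F : cube -> R) :
  (2 ^ m)%:R * \sum_A \sum_(D | weight D == k)
      (F A * F (cube_add A D) + F A * F (cube_opp (cube_add A D))) =
  \sum_T krawtchouk k T * (1 + (-1) ^+ weight T) * fourier F T ^+ 2.
Proof.
transitivity ((2 ^ m)%:R * \sum_A F A * \sum_(D | weight D == k)
    (fun B => F B + F (cube_opp B)) (cube_add A D)).
  congr (_ * _); apply: eq_bigr => A _; rewrite mulr_sumr.
  by apply: eq_bigr => D _; rewrite mulrDr.
rewrite -(parseval F (fun A => \sum_(D | weight D == k)
    (fun B => F B + F (cube_opp B)) (cube_add A D))).
apply: eq_bigr => T _.
by rewrite (fourier_convolution k (fun B => F B + F (cube_opp B))) fourier_even; ring.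
Qed.

Lemma parseval_shell k : \sum_T krawtchouk k T ^+ 2 =
  (2 ^ m)%:R * krawtchouk k [ffun=> false].
Proof.
transitivity (\sum_T fourier (fun D => (weight D == k)%:R) T *
    fourier (fun D => (weight D == k)%:R) T).
  by apply: eq_bigr => T _; rewrite fourier_shell.
rewrite parseval -fourier_shell; congr (_ * _); apply: eq_bigr => D _.
by rewrite character0; case: eqP; rewrite /= ?mulr1 ?mulr0.
Qed.

(** In [parseval_convolution] the trivial character gives the main term, odd characters vanish, and
    each other even one loses at most [2 * e] times the sphere size times its squared coefficient.
    Parseval adds up these losses. *)
Lemma convolution_ge k (F : cube -> R) (e : R) : 0 <= e ->
  (forall T, - (e * krawtchouk k [ffun=> false]) <= krawtchouk k T) ->
  2 * krawtchouk k [ffun=> false] * (\sum_A F A) ^+ 2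
    - 2 * e * krawtchouk k [ffun=> false] * (2 ^ m)%:R * \sum_A F A ^+ 2 <=
  (2 ^ m)%:R * \sum_A \sum_(D | weight D == k)
      (F A * F (cube_add A D) + F A * F (cube_opp (cube_add A D))).
Proof.
move=> e0 kr_ge; rewrite parseval_convolution.
set C := krawtchouk k _.
have C0 : 0 <= C.
  by apply: sumr_ge0 => D _; rewrite character0.
have F2 : (2 ^ m)%:R * \sum_A F A ^+ 2 = \sum_T fourier F T ^+ 2.
  rewrite (eq_bigr (fun A => F A * F A)); last by move=> A _; rewrite expr2.
  by rewrite -parseval; apply: eq_bigr => T _; rewrite expr2.
set s := \sum_A F A; rewrite -!mulrA F2 (bigD1 [ffun=> false])//= -/C.
rewrite [X in _ <= X](bigD1 [ffun=> false])//= -/C.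
have -> : weight [ffun=> false] = 0%N by rewrite /weight big1// => i _; rewrite ffunE.
have -> : fourier F [ffun=> false] = s.
  by apply: eq_bigr => A _; rewrite character0 mulr1.
rewrite expr0 -subr_ge0 mulrDr.
set S1 := \sum_(T | _) fourier F T ^+ 2.
set S2 := \sum_(T | _) _.
have S12 : - (2 * (e * C) * S1) <= S2.
  rewrite /S1 /S2 mulr_sumr -sumrN; apply: ler_sum => T _.
  have := kr_ge T; rewrite -/C => krT.
  have q0 := sqr_ge0 (fourier F T).
  rewrite -signr_odd; case: odd; rewrite /= ?expr1 ?expr0.
    have := mulr_ge0 (mulr_ge0 e0 C0) q0; lra.
  have : 0 <= (krawtchouk k T + e * C) * fourier F T ^+ 2.
    by rewrite mulr_ge0// -lerBlDr sub0r.
  lra.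
(* The error term also charges the trivial character; this surplus has the right sign. *)
have := mulr_ge0 (mulr_ge0 e0 C0) (sqr_ge0 s); lra.
Qed.

End HammingCube.

(** * Binomial coefficients and Krawtchouk polynomials *)

Lemma expn_le_bin (a n k : nat) : (a * k <= n)%N -> (a ^ k <= 'C(n, k))%N.
Proof.
elim: k n => [|k IH] n akn; first by rewrite expn0 bin0.
case: a => [|a] in IH akn *; first by rewrite exp0n.
have n0 : (0 < n)%N by lia.
have /IH aC : (a.+1 * k <= n.-1)%N by nia.
(* Absorption: [k.+1 * 'C(n, k.+1)] equals [n * 'C(n.-1, k)], and [n] is at least [a.+1 * k.+1]. *)
rewrite -(leq_pmul2l (ltn0Sn k)) -mul_bin_diag expnS.
apply: leq_trans (leq_mul akn aC).
by rewrite mulnA leq_mul2r mulnC leqnn orbT.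
Qed.

Lemma leq_bin_half n j k : (j <= k)%N -> (k + k <= n)%N ->
  ('C(n, j) <= 'C(n, k))%N.
Proof.
move=> /subnK <-; elim: (k - j)%N => [|i IH] // kn; rewrite addSn in kn *.
apply: leq_trans (IH _) _; first by lia.
rewrite -(leq_pmul2l (ltn0Sn (i + j))) mul_bin_left leq_mul2r.
by apply/orP; right; lia.
Qed.

(** The hypotheses place [k] between [j] and [n - j]; past the middle, the symmetry of binomial
    coefficients reduces to [leq_bin_half]. *)
Lemma leq_bin_middle n j k : (j <= k)%N -> (k + j <= n)%N ->
  ('C(n, j) <= 'C(n, k))%N.
Proof.
move=> jk kjn; have [kn|kn] := leqP (k + k) n; first exact: leq_bin_half.
rewrite -(@bin_sub n k); last by lia.
by apply: leq_bin_half; lia.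
Qed.

(* [4p] maximises [C(16p, i) 3^(16p - i)], and these terms sum to [4^16p]. *)
Lemma expn_le_bin_quarter p :
  (4 ^ (16 * p) <= (16 * p).+1 * ('C(16 * p, 4 * p) * 3 ^ (12 * p)))%N.
Proof.
set n := (16 * p)%N; pose t i := ('C(n, i) * 3 ^ (n - i))%N.
have tk : t (4 * p)%N = ('C(16 * p, 4 * p) * 3 ^ (12 * p))%N.
  by rewrite /t /n; congr (_ * _ ^ _)%N; lia.
(* A common factor for comparing neighbours: [t i.+1 / t i] is [(n - i) / (3 * i.+1)], which passes
   1 at [i = 4 * p]. *)
pose w i := ('C(n, i) * 3 ^ (n - i.+1))%N.
have tS i : (i.+1 * t i.+1 = (n - i) * w i)%N.
  by rewrite /t mulnA mul_bin_left mulnA.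
have tE i : (i < n)%N -> (i.+1 * t i = 3 * i.+1 * w i)%N.
  by move=> ni; rewrite /t /w -(subnSK ni) expnS; ring.
have up i : (i < 4 * p)%N -> (t i <= t i.+1)%N.
  move=> ip; rewrite -(leq_pmul2l (ltn0Sn i)) tS tE; last by rewrite /n; lia.
  by rewrite leq_mul2r; apply/orP; right; rewrite /n; lia.
have down i : (4 * p <= i)%N -> (t i.+1 <= t i)%N.
  move=> ip; have [ni|ni] := leqP n i; first by rewrite /t bin_small.
  rewrite -(leq_pmul2l (ltn0Sn i)) tS tE//.
  by rewrite leq_mul2r; apply/orP; right; rewrite /n; lia.
have tmax i : (t i <= t (4 * p))%N.
  have [ip|ip] := leqP i (4 * p).
    rewrite -(subKn ip); elim: (4 * p - i)%N => [|l IH]; first by rewrite subn0.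
    have [lp|lp] := ltnP l (4 * p); last first.
      by rewrite (_ : (_ - l.+1)%N = (4 * p - l)%N); [|lia].
    by apply: leq_trans IH; rewrite -(subnSK lp); apply: up; lia.
  rewrite -(subnK (ltnW ip)); elim: (i - 4 * p)%N => [|l IH]//.
  by rewrite addSn; apply: leq_trans IH; apply: down; lia.
rewrite -tk -[4%N]/(3 + 1)%N expnDn.
apply: (@leq_trans (\sum_(i < n.+1) t (4 * p)%N)).
  by apply: leq_sum => i _; rewrite exp1n muln1; exact: tmax.
by rewrite sum_nat_const card_ord.
Qed.

Section KrawtchoukEstimates.
Context {R : realFieldType}.

(** The generating function, in the radius [k], of the Krawtchouk values at weight [j]. *)
Definition krawtchouk_poly m j : {poly R} := (1 - 'X) ^+ j * (1 + 'X) ^+ (m - j).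

Lemma krawtchouk_coef m k (T : {ffun 'I_m -> bool}) :
  krawtchouk k T = (krawtchouk_poly m (weight T))`_k :> R.
Proof.
have -> : krawtchouk_poly m (weight T) =
    \sum_(D : {ffun 'I_m -> bool}) character T D *: 'X^(weight D).
  transitivity (\prod_(i < m) (1 + (-1) ^+ T i *: 'X) : {poly R}).
    rewrite (bigID T)/= (eq_bigr (fun=> 1 - 'X)); last first.
      by move=> i ->; rewrite expr1 scaleN1r.
    rewrite [X in _ * X](eq_bigr (fun=> 1 + 'X)); last first.
      by move=> i /negbTE ->; rewrite expr0 scale1r.
    have wT : weight T = #|[pred i | T i]|.
      rewrite /weight -sum1_card [RHS]big_mkcond/=.
      by apply: eq_bigr => i _; rewrite unfold_in /=; case: (T i).
    rewrite !prodr_const /krawtchouk_poly wT; congr (_ * _ ^+ _).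
    transitivity #|[predC [pred i | T i]]| => //.
    have := cardC [pred i | T i]; rewrite card_ord => c.
    by rewrite -[X in (X - _)%N = _]c addKn.
  transitivity (\prod_(i < m) \sum_(b : bool) ((-1) ^+ (T i && b) *: 'X^b) : {poly R}).
    apply: eq_bigr => i _; rewrite big_bool/= andbT andbF expr0 expr1.
    by rewrite scale1r addrC.
  rewrite bigA_distr_bigA; apply: eq_bigr => D _.
  by rewrite scaler_prod; congr (_ *: _); exact: prodrXr.
rewrite coef_sum /krawtchouk big_mkcond; apply: eq_bigr => D _.
rewrite coefZ coefXn eq_sym; case: eqP; by rewrite ?mulr1 ?mulr0.
Qed.

Lemma krawtchouk0 m k :
  krawtchouk k ([ffun=> false] : {ffun 'I_m -> bool}) = 'C(m, k)%:R :> R.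
Proof.
rewrite krawtchouk_coef (_ : weight _ = 0%N); last first.
  by rewrite /weight big1// => i _; rewrite ffunE.
rewrite /krawtchouk_poly expr0 mul1r subn0.
have -> : (1 + 'X) ^+ m = \poly_(i < m.+1) 'C(m, i)%:R :> {poly R}.
  rewrite poly_def exprDn; apply: eq_bigr => i _.
  by rewrite expr1n mul1r scaler_nat.
by rewrite coef_poly ltnS; case: leqP => // mk; rewrite bin_small.
Qed.

(** The logarithmic derivative is [(m - j) / (1 + X) - j / (1 - X)]; clear denominators. Comparing
    coefficients then gives a three-term recurrence. *)
Lemma krawtchouk_poly_ode m j : (j <= m)%N ->
  (1 - 'X^2) * (krawtchouk_poly m j)^`() =
  ((m%:R - j.*2%:R)%:P - m%:R *: 'X) * krawtchouk_poly m j.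
Proof.
move=> jm; rewrite /krawtchouk_poly.
(* The extra factor [q] avoids the exponent [n - 1], which would truncate at [n = 0]. *)
have dX (q : {poly R}) n : q * (q ^+ n)^`() = n%:R *: (q^`() * q ^+ n).
  case: n => [|n]; first by rewrite expr0 derivC mulr0 scale0r.
  by rewrite deriv_exp /= exprS scaler_nat mulrnAr mulrCA.
rewrite derivM mulrDr.
have -> : 1 - 'X^2 = (1 - 'X) * (1 + 'X) :> {poly R} by ring.
rewrite [X in X + _](_ : _ = (1 + 'X) * (1 + 'X) ^+ (m - j) *
  ((1 - 'X) * ((1 - 'X) ^+ j)^`())); last by ring.
rewrite [X in _ + X](_ : _ = (1 - 'X) * (1 - 'X) ^+ j *
  ((1 + 'X) * ((1 + 'X) ^+ (m - j))^`())); last by ring.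
rewrite !dX derivB derivD derivC derivX sub0r add0r mulN1r mul1r.
rewrite -!mul_polyC natrB// -mul2n natrM !rmorphB rmorphM/=.
ring.
Qed.

Lemma krawtchouk_poly_coef0 m j : (krawtchouk_poly m j)`_0 = 1.
Proof.
rewrite -horner_coef0 /krawtchouk_poly hornerM !horner_exp !hornerE.
by rewrite ?subr0 ?addr0 ?expr1n ?mulr1.
Qed.

Lemma krawtchouk_poly_coef1 m j : (j <= m)%N ->
  (krawtchouk_poly m j)`_1 = m%:R - j.*2%:R.
Proof.
move=> jm; have := congr1 (fun q : {poly R} => q`_0) (krawtchouk_poly_ode jm).
rewrite !mulrBl mul1r !coefB coefCM -scalerAl coefZ coefXM mulr0 subr0 /=.
rewrite coefXnM/= subr0 coef_deriv krawtchouk_poly_coef0 mulr1.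
by rewrite mulr1n.
Qed.

Lemma krawtchouk_poly_coefSS m j k : (j <= m)%N ->
  k.+2%:R * (krawtchouk_poly m j)`_k.+2 =
  (m%:R - j.*2%:R) * (krawtchouk_poly m j)`_k.+1 -
  (m%:R - k%:R) * (krawtchouk_poly m j)`_k.
Proof.
move=> jm; have := congr1 (fun q : {poly R} => q`_k.+1) (krawtchouk_poly_ode jm).
rewrite mulrBl [in X in _ = X -> _]mulrBl mul1r !coefB coefCM.
rewrite -scalerAl coefZ coefXM/= coefXnM !coef_deriv.
have -> : (if (k.+1 < 2)%N then 0
    else (krawtchouk_poly m j)`_(k.+1 - 2).+1 *+ (k.+1 - 2).+1) =
    k%:R * (krawtchouk_poly m j)`_k.
  case: k => [|k]; first by rewrite mul0r.
  by rewrite ltnNge/= !subSS subn0 mulr_natl.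
rewrite -[_ *+ k.+2]mulr_natl.
by move/eqP; rewrite subr_eq => /eqP ->; ring.
Qed.

(* Below the first zero the coefficients at least double at each step. *)
Lemma krawtchouk_poly_coef_ge0 p j k : (j < p)%N -> (k <= 4 * p)%N ->
  0 <= (krawtchouk_poly (16 * p) j)`_k.
Proof.
move=> jp; pose c i : R := (krawtchouk_poly (16 * p) j)`_i.
have jm : (j <= 16 * p)%N by lia.
suff dbl i : (i < 4 * p)%N -> 0 <= c i /\ 2 * c i <= c i.+1.
  case: k => [_|k kp]; first by rewrite krawtchouk_poly_coef0.
  by have [c0 c1] := dbl k kp; apply: le_trans c1; rewrite mulr_ge0.
elim: i => [_|i IH ip].
  rewrite /c krawtchouk_poly_coef0 krawtchouk_poly_coef1// mulr1; split=> //.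
  by rewrite -natrB ?ler_nat; lia.
have [c0 c1] := IH (ltnW ip); have cS0 : 0 <= c i.+1 by apply: le_trans c1; rewrite mulr_ge0.
split=> //; rewrite -(ler_pM2l (ltr0Sn R i.+1)) krawtchouk_poly_coefSS// -/(c _) -/(c _).
have m_i : 0 <= (16 * p)%:R - i%:R :> R by rewrite subr_ge0 ler_nat; lia.
have := ler_wpM2l m_i c1.
(* Once [c i] is bounded by half of [c i.+1] in the recurrence, doubling at the next step reduces to
   this inequality; it is where [i.+1 < 4 * p] and [j < p] enter. *)
have : (4 * i.+2 + 2 * j.*2)%:R <= (16 * p + i)%:R :> R by rewrite ler_nat; lia.
rewrite (natrD _ (4 * i.+2)) (natrD _ (16 * p)) (natrM _ 4) (natrM _ 2).
move=> /(ler_wpM2r cS0).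
lra.
Qed.

End KrawtchoukEstimates.

Lemma card_weight m j : #|[pred T : {ffun 'I_m -> bool} | weight T == j]| = 'C(m, j).
Proof.
apply/eqP; rewrite -(eqr_nat rat) -krawtchouk0 /krawtchouk; apply/eqP.
rewrite (eq_bigr (fun=> 1)); last by move=> D _; rewrite character0.
by rewrite sumr_const.
Qed.

(** Each character in the sum changes by the sign of parity [k]. This carries nonnegativity from low
    weights to high ones. *)
Lemma krawtchouk_opp (R : realFieldType) m k (T : {ffun 'I_m -> bool}) :
  ~~ odd k -> krawtchouk k (cube_opp T) = krawtchouk k T :> R.
Proof.
move=> ek; apply: eq_bigr => D /eqP wD.
by rewrite characterC character_opp wD -signr_odd (negbTE ek) mul1r characterC.
Qed.

(* The value at [T] is repeated at all points of the same weight in Parseval's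
   identity. *)
Lemma krawtchouk_sqr_le (R : realFieldType) m k (T : {ffun 'I_m -> bool}) :
  krawtchouk k T ^+ 2 * 'C(m, weight T)%:R <= (2 ^ m)%:R * 'C(m, k)%:R :> R.
Proof.
rewrite -(krawtchouk0 m k) -parseval_shell (bigID (fun T' => weight T' == weight T))/=.
rewrite (eq_bigr (fun=> krawtchouk k T ^+ 2)); last first.
  by move=> T' /eqP wT; rewrite !krawtchouk_coef wT.
have -> : krawtchouk k T ^+ 2 * 'C(m, weight T)%:R =
    \sum_(T' : {ffun 'I_m -> bool} | weight T' == weight T) krawtchouk k T ^+ 2 :> R.
  by rewrite -card_weight mulr_natr -sumr_const.
by rewrite lerDl; apply: sumr_ge0 => T' _; exact: sqr_ge0.
Qed.

(** Weights below [p] or above [15 * p] give nonnegative values. In between, the multiplicity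
    ['C(16 * p, weight T)] is at least [16 ^ p], so [krawtchouk_sqr_le] bounds the square of the
    value. Dividing by the squared sphere size and using [expn_le_bin_quarter] leaves the ratio [2 ^
    16 * 3 ^ 12 / (16 * 4 ^ 16) = 3 ^ 12 / 2 ^ 20] per unit of [p]. *)
Lemma krawtchouk_ge (R : realFieldType) p (T : {ffun 'I_(16 * p) -> bool}) (e : R) :
  0 <= e -> (16 * p).+1%:R * (3 ^+ 12 / 2 ^+ 20) ^+ p <= e ^+ 2 ->
  - (e * 'C(16 * p, 4 * p)%:R) <= krawtchouk (4 * p) T.
Proof.
move=> e0 ep; set C : R := 'C(16 * p, 4 * p)%:R.
have C0 : 0 < C by rewrite ltr0n bin_gt0; lia.
have neg0 : - (e * C) <= 0 by rewrite oppr_le0 mulr_ge0// ltW.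
have wT := weight_le T.
have [Tp|pT] := ltnP (weight T) p.
  by apply: le_trans neg0 _; rewrite krawtchouk_coef krawtchouk_poly_coef_ge0.
have [Tp|Tp] := ltnP (15 * p) (weight T).
  apply: le_trans neg0 _; rewrite -krawtchouk_opp; last by rewrite oddM.
  by rewrite krawtchouk_coef krawtchouk_poly_coef_ge0// weight_opp; lia.
set K := krawtchouk (4 * p) T.
have binT : (16 ^ p)%:R <= 'C(16 * p, weight T)%:R :> R.
  rewrite ler_nat; apply: leq_trans (@expn_le_bin 16 (16 * p) p (leqnn _)) _.
  by apply: leq_bin_middle => //; lia.
have binC : (4 ^ (16 * p))%:R <= (16 * p).+1%:R * (C * (3 ^ (12 * p))%:R) :> R.
  by rewrite -!natrM ler_nat expn_le_bin_quarter.
have K2 : K ^+ 2 * (16 ^ p)%:R <= (2 ^ (16 * p))%:R * C.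
  by apply: le_trans (krawtchouk_sqr_le R (4 * p) T); rewrite ler_wpM2l// sqr_ge0.
suff : `|K| <= e * C by rewrite ler_norml => /andP[].
have eC0 : 0 <= e * C by rewrite mulr_ge0// ltW.
rewrite -(@ler_pXn2r _ 2) ?nnegrE// real_normK ?num_real//.
have s0 : 0 < (16 ^ p)%:R :> R by rewrite ltr0n expn_gt0.
rewrite -(ler_pM2r s0); apply: le_trans K2 _.
have t0 : 0 < (4 ^ (16 * p))%:R :> R by rewrite ltr0n expn_gt0.
rewrite -(ler_pM2r t0).
apply: le_trans (_ : (2 ^ (16 * p))%:R * C *
    ((16 * p).+1%:R * (C * (3 ^ (12 * p))%:R)) <= _).
  by rewrite ler_wpM2l// mulr_ge0// ltW.
set M : R := (16 * p).+1%:R in ep *.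
have -> : (2 ^ (16 * p))%:R * C * (M * (C * (3 ^ (12 * p))%:R)) =
    M * (3 ^+ 12 / 2 ^+ 20) ^+ p * (C ^+ 2 * ((16 ^ p)%:R * (4 ^ (16 * p))%:R)).
  rewrite expr_div_n !natrX !exprM.
  have -> : 4 ^+ 16 = 2 ^+ 12 * 2 ^+ 20 :> R by ring.
  have -> : 2 ^+ 16 = 16 * 2 ^+ 12 :> R by ring.
  rewrite !exprMn; by field; rewrite !expf_neq0// pnatr_eq0.
rewrite [leRHS](_ : _ = e ^+ 2 * (C ^+ 2 * ((16 ^ p)%:R * (4 ^ (16 * p))%:R))).
  by rewrite ler_wpM2r// !mulr_ge0// sqr_ge0.
by rewrite exprMn !mulrA.
Qed.

(** * Invariance of Lebesgue measure under orthogonal maps *)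

Definition measure_preserving d (T : measurableType d) (R : realType)
    (mu : set T -> \bar R) (f : T -> T) :=
  measurable_fun setT f /\
  forall A, measurable A -> mu (f @^-1` A) = mu A.

Lemma measurable_preimage d1 d2 (T1 : measurableType d1)
    (T2 : measurableType d2) (f : T1 -> T2) A :
  measurable_fun setT f -> measurable A -> measurable (f @^-1` A).
Proof. by move=> mf mA; rewrite -[X in measurable X]setTI; exact: mf. Qed.

(** The pushforward of the product measure agrees with it on measurable rectangles, which determine
    it. *)
Lemma product_measure_preserving d1 d2 (T1 : measurableType d1)
    (T2 : measurableType d2) (R : realType)
    (m1 : {sigma_finite_measure set T1 -> \bar R})
    (m2 : {sigma_finite_measure set T2 -> \bar R}) f g :
  measure_preserving m1 f -> measure_preserving m2 g ->
  measure_preserving (m1 \x m2)%E (fun p => (f p.1, g p.2)).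
Proof.
move=> [mf fm] [mg gm]; have mfg : measurable_fun setT
    (fun p : T1 * T2 => (f p.1, g p.2)).
  apply/measurable_fun_pairP; split.
    exact: (measurableT_comp mf measurable_fst).
  exact: (measurableT_comp mg measurable_snd).
split=> // A mA; pose mu : {measure set (T1 * T2) -> \bar R} :=
  pushforward (m1 \x m2)%E (fun p : T1 * T2 => (f p.1, g p.2)).
suff -> : (m1 \x m2)%E A = mu mfg A by [].
apply: product_measure_unique => // B C mB mC.
rewrite /mu /= /pushforward -[LHS]/((m1 \x m2)%E ((f @^-1` B) `*` (g @^-1` C))).
rewrite product_measure1E; [|exact: measurable_preimage..].
by congr (_ * _)%E; [exact: fm|exact: gm].
Qed.

Lemma lebesgue_measure_translation (R : realType) (t : R) :
  measure_preserving (@lebesgue_measure R)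
    (fun x : measurableTypeR R => x + t : measurableTypeR R).
Proof.
have mt : measurable_fun [set: measurableTypeR R]
    (fun x : measurableTypeR R => x + t : measurableTypeR R).
  exact: measurable_funD.
split=> // A mA; apply/esym.
pose mu : {measure set (measurableTypeR R) -> \bar R} :=
  pushforward (@lebesgue_measure R)
    (fun x : measurableTypeR R => x + t : measurableTypeR R).
rewrite -[RHS]/(mu mt A); apply: lebesgue_measure_unique => // _ [[a b]] _ <-.
rewrite /mu/= /pushforward.
rewrite (_ : _ @^-1` _ = `](a - t), (b - t)]%classic); last first.
  by apply/seteqP; split=> x /=; rewrite !in_itv/= ltrBlDr lerBrDr.
rewrite !lebesgue_measure_itv/= !lte_fin ltrD2r.
by case: ifP => // _; rewrite -!EFinB opprD opprK addrACA addNr addr0.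
Qed.

(** Induction along the recursive construction of [lebesgue_rV]: [rV_cons] intertwines the map on
    vectors with a product map. Translations and negation are the two instances. *)
Lemma lebesgue_rV_coordinatewise (R : realType) d (h : 'I_d -> R -> R) :
  (forall i, measure_preserving (@lebesgue_measure R)
    (h i : measurableTypeR R -> measurableTypeR R)) ->
  measure_preserving (lebesgue_rV R d)
    (fun v : rVborel R d => \row_i h i ((v : 'rV[R]_d) ord0 i) : rVborel R d).
Proof.
elim: d h => [|d IH] h hh.
  set f := (fun v => _); have -> : f = id.
    by apply/funext => v; apply/rowP; case.
  by split => //; exact: measurable_id.
have [mf fm] := product_measure_preserving (hh ord0)
  (IH (fun i => h (lift ord0 i)) (fun i => hh _)).
have mrow : measurable_fun setT (fun v : rVborel R d.+1 =>
    \row_i h i ((v : 'rV[R]_d.+1) ord0 i) : rVborel R d.+1).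
  apply: measurable_fun_rV => i.
  apply: (eq_measurable_fun (fun v : rVborel R d.+1 =>
      h i ((v : 'rV[R]_d.+1) ord0 i) : measurableTypeR R)).
    by move=> v _; rewrite mxE.
  by apply: measurableT_comp; [case: (hh i)|exact: measurable_rV_coord].
split=> // A mA; rewrite /= /lebesgue_cons /pushforward.
rewrite -[RHS]fm; last by apply: measurable_preimage => //; exact: measurable_rV_cons.
congr (product_measure1 _ _ _); apply/seteqP.
suff e (p : measurableTypeR R * rVborel R d) :
    (\row_i h i ((rV_cons p : 'rV[R]_d.+1) ord0 i) : rVborel R d.+1) =
    rV_cons (h ord0 p.1 : measurableTypeR R,
             \row_i h (lift ord0 i) ((p.2 : 'rV[R]_d) ord0 i) : rVborel R d).
  by split=> p /=; rewrite e.
apply/rowP => i; have [j ->|->] := unliftP ord0 i.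
  by rewrite [LHS]mxE !rV_cons_lift [RHS]mxE.
by rewrite [LHS]mxE !rV_cons_ord0.
Qed.

Lemma lebesgue_rV_translation (R : realType) d (t : 'rV[R]_d) :
  measure_preserving (lebesgue_rV R d)
    (fun v : rVborel R d => (v : 'rV[R]_d) + t : rVborel R d).
Proof.
have -> : (fun v : rVborel R d => (v : 'rV[R]_d) + t : rVborel R d) =
    (fun v => \row_i ((v : 'rV[R]_d) ord0 i + t ord0 i)).
  by apply/funext => v; apply/rowP => i; rewrite !mxE.
by apply: (lebesgue_rV_coordinatewise (h := fun i x => x + t ord0 i)) => i;
  exact: lebesgue_measure_translation.
Qed.

Lemma lebesgue_rV_opp (R : realType) d :
  measure_preserving (lebesgue_rV R d)
    (fun v : rVborel R d => - (v : 'rV[R]_d) : rVborel R d).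
Proof.
have -> : (fun v : rVborel R d => - (v : 'rV[R]_d) : rVborel R d) =
    (fun v => \row_i - ((v : 'rV[R]_d) ord0 i)).
  by apply/funext => v; apply/rowP => i; rewrite !mxE.
apply: (lebesgue_rV_coordinatewise (h := fun=> -%R)) => i; split.
  exact: measurable_funN.
by move=> A mA; exact: lebesgue_measureN.
Qed.

Section MeasurableVectorOperations.
Context d (T : measurableType d) (R : realType) (n : nat).
Implicit Types f g : T -> rVborel R n.

Lemma measurable_fun_rV_coord f i : measurable_fun setT f ->
  measurable_fun setT (fun x => (f x : 'rV[R]_n) ord0 i : measurableTypeR R).
Proof. exact: (measurableT_comp (measurable_rV_coord i)). Qed.

Lemma measurable_rV_add f g : measurable_fun setT f -> measurable_fun setT g ->
  measurable_fun setT (fun x => (f x : 'rV[R]_n) + (g x : 'rV[R]_n) : rVborel R n).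
Proof.
move=> mf mg; apply: measurable_fun_rV => i.
apply: (eq_measurable_fun (fun x =>
    (f x : 'rV[R]_n) ord0 i + (g x : 'rV[R]_n) ord0 i)).
  by move=> x _; rewrite mxE.
by apply: measurable_funD; exact: measurable_fun_rV_coord.
Qed.

Lemma measurable_rV_opp f : measurable_fun setT f ->
  measurable_fun setT (fun x => - (f x : 'rV[R]_n) : rVborel R n).
Proof.
move=> mf; apply: measurable_fun_rV => i.
apply: (eq_measurable_fun (\- (fun x => (f x : 'rV[R]_n) ord0 i))).
  by move=> x _; rewrite mxE.
by apply: measurable_funN; exact: measurable_fun_rV_coord.
Qed.

Lemma measurable_rV_mulmx k f (P : T -> 'M[R]_(n, k)) :
  measurable_fun setT f ->
  (forall i j, measurable_fun setT (fun x => P x i j : measurableTypeR R)) ->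
  measurable_fun setT (fun x => (f x : 'rV[R]_n) *m P x : rVborel R k).
Proof.
move=> mf mP; apply: measurable_fun_rV => i.
apply: (eq_measurable_fun (fun x =>
    \sum_j (f x : 'rV[R]_n) ord0 j * P x j i)).
  by move=> x _; rewrite mxE.
apply: measurable_sum => j; apply: measurable_funM; last exact: mP.
exact: measurable_fun_rV_coord.
Qed.

Lemma measurable_euclidean_norm f : measurable_fun setT f ->
  measurable_fun setT (fun x => euclidean_norm (f x : 'rV[R]_n)).
Proof.
move=> mf; apply: (measurableT_comp (f := @Num.sqrt R)).
  by apply: continuous_measurable_fun; exact: sqrt_continuous.
apply: measurable_sum => i; apply: measurable_funX.
exact: measurable_fun_rV_coord.
Qed.

End MeasurableVectorOperations.

(** * Euclidean norm, balls and boxes *)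

Section EuclideanNorm.
Context {R : realType} {n : nat}.
Implicit Types u v : 'rV[R]_n.

Lemma mulmx_trE u v : (u *m v^T) ord0 ord0 = \sum_i u ord0 i * v ord0 i.
Proof. by rewrite mxE; apply: eq_bigr => i _; rewrite mxE. Qed.

Lemma euclidean_normE u : euclidean_norm u = Num.sqrt ((u *m u^T) ord0 ord0).
Proof. by rewrite mulmx_trE. Qed.

Lemma sqr_euclidean_norm u : euclidean_norm u ^+ 2 = (u *m u^T) ord0 ord0.
Proof.
rewrite euclidean_normE sqr_sqrtr// mulmx_trE.
by apply: sumr_ge0 => i _; rewrite -expr2 sqr_ge0.
Qed.

Lemma euclidean_norm_ge0 u : 0 <= euclidean_norm u.
Proof. exact: sqrtr_ge0. Qed.

Lemma euclidean_norm_orthogonal (P : 'M[R]_n) u :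
  P *m P^T = 1%:M -> euclidean_norm (u *m P) = euclidean_norm u.
Proof.
by move=> PP; rewrite !euclidean_normE trmx_mul mulmxA -(mulmxA u) PP mulmx1.
Qed.

Lemma euclidean_normZ (a : R) u : 0 <= a ->
  euclidean_norm (a *: u) = a * euclidean_norm u.
Proof.
move=> a0; rewrite !euclidean_normE linearZ/= -scalemxAl -scalemxAr scalerA mxE.
by rewrite sqrtrM ?mulr_ge0// -expr2 sqrtr_sqr ger0_norm.
Qed.

Lemma euclidean_norm_eq0 u : euclidean_norm u = 0 -> u = 0.
Proof.
move=> /(congr1 (fun x => x ^+ 2)); rewrite sqr_euclidean_norm expr0n/= mulmx_trE.
move=> /eqP; rewrite psumr_eq0; last by move=> i _; rewrite -expr2 sqr_ge0.
move=> /allP u0; apply/rowP => i; rewrite mxE.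
by have /(_ (mem_index_enum i)) := u0 i; rewrite mulf_eq0 orbb => /eqP.
Qed.

Lemma closed_euclidean_ball0E r :
  closed_euclidean_ball 0 r = [set v : 'rV[R]_n | euclidean_norm v <= r].
Proof. by apply/seteqP; split=> v; rewrite /closed_euclidean_ball/= subr0. Qed.

Lemma borel_closed_euclidean_ball r : borel (closed_euclidean_ball (0 : 'rV[R]_n) r).
Proof.
rewrite /borel closed_euclidean_ball0E.
rewrite (_ : [set _ | _] =
  (fun v : rVborel R n => euclidean_norm (v : 'rV[R]_n)) @^-1` `]-oo, r]).
  apply: measurable_preimage => //; apply: measurable_euclidean_norm.
  exact: measurable_id.
by apply/seteqP; split=> v /=; rewrite in_itv.
Qed.

Lemma lebesgue_rV_cube_lt_pinfty (r : R) :
  (lebesgue_rV R n [set v : 'rV[R]_n | forall i, (`|v ord0 i| <= r)%R] < +oo)%E.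
Proof.
rewrite (_ : [set _ | _] = [set v : 'rV[R]_n | forall i, `[- r, r]%classic (v ord0 i)]); last first.
  by apply/seteqP; split=> v /= vr i; have := vr i; rewrite in_itv/= ler_norml.
rewrite (lebesgue_rV_box (A := fun=> `[- r, r]%classic)) => [|i]; last exact: measurable_itv.
rewrite big_const; elim: #|_| => [|k IH]/=; first exact: ltry.
apply: lte_mul_pinfty => //.
by rewrite lebesgue_measure_itv/=; case: ifP => // _; exact: ltry.
Qed.

Lemma lebesgue_rV_box_gt0 (A : set 'rV[R]_n) (a b : 'I_n -> R) : borel A ->
  (forall i, a i < b i) ->
  (forall v : 'rV[R]_n, (forall i, a i <= v ord0 i <= b i) -> A v) ->
  (0 < lebesgue_rV R n A)%E.
Proof.
move=> mA ab subA.
have mI i : measurable (`[a i, b i] : set (measurableTypeR R)).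
  exact: measurable_itv.
have -> : A = A `|` [set v : 'rV[R]_n | forall i, `[a i, b i]%classic (v ord0 i)].
  apply/esym/setUidl => v /= vab; apply: subA => i.
  by move: (vab i); rewrite in_itv.
have mB : borel [set v : 'rV[R]_n | forall i, `[a i, b i]%classic (v ord0 i)].
  rewrite (_ : [set _ | _] = \bigcap_(i in [set: 'I_n])
      ((fun v : rVborel R n => (v : 'rV[R]_n) ord0 i) @^-1` `[a i, b i])).
    apply: fin_bigcap_measurable => // i _.
    by apply: measurable_preimage => //; exact: measurable_rV_coord.
  by apply/seteqP; split=> v /=; [move=> h i _; exact: h|move=> h i; exact: h].
apply: (@lt_le_trans _ _ (lebesgue_rV R n [set v : 'rV[R]_n | forall i, `[a i, b i]%classic (v ord0 i)])).
  rewrite (lebesgue_rV_box (A := fun i => `[a i, b i]%classic))//.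
  apply: (big_ind (fun x => 0 < x)%E) => // [x y x0 y0|i _]; first exact: mule_gt0.
  by rewrite lebesgue_measure_itv/= lte_fin ab -EFinB lte_fin subr_gt0.
apply: le_measure; rewrite ?inE; last exact: subsetUr.
  exact: mB.
exact: measurableU.
Qed.

End EuclideanNorm.

Lemma closed_euclidean_ball_lt_pinfty (R : realType) n (r : R) :
  (lebesgue_rV R n (closed_euclidean_ball 0 r) < +oo)%E.
Proof.
apply: le_lt_trans (lebesgue_rV_cube_lt_pinfty `|r|).
apply: le_measure; rewrite ?inE.
- exact: borel_closed_euclidean_ball.
- rewrite (_ : [set _ | _] = \bigcap_(i in [set: 'I_n])
      ((fun v : rVborel R n => (v : 'rV[R]_n) ord0 i) @^-1` `[- `|r|, `|r|])).
    apply: fin_bigcap_measurable => // i _.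
    by apply: measurable_preimage => //; exact: measurable_rV_coord.
  apply/seteqP; split=> v /=.
    by move=> h i _; have := h i; rewrite /= in_itv/= ler_norml.
  by move=> h i; have := h i I; rewrite /= in_itv/= ler_norml.
rewrite closed_euclidean_ball0E => v /= vr i.
apply: le_trans (ler_norm r); apply: le_trans vr.
rewrite -[X in X <= _]sqrtr_sqr ler_wsqrtr// (bigD1 i)//=.
by rewrite lerDl sumr_ge0// => j _; exact: sqr_ge0.
Qed.

Lemma closed_euclidean_ball_gt0 (R : realType) n :
  (0 < lebesgue_rV R n (closed_euclidean_ball 0 1))%E.
Proof.
(* On this box every squared coordinate is at most [1 / (n + 1)], so the squared norm is at most
   [n / (n + 1)]. *)
apply: (@lebesgue_rV_box_gt0 _ _ _ (fun=> 0) (fun=> n.+1%:R^-1)).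
- exact: borel_closed_euclidean_ball.
- by move=> i; rewrite invr_gt0.
- move=> v vn; rewrite closed_euclidean_ball0E /= -sqrtr1 ler_wsqrtr//.
  apply: (@le_trans _ _ (\sum_(i < n) n.+1%:R^-1)).
    apply: ler_sum => i _; have /andP[v0 v1] := vn i.
    rewrite expr2 -[leRHS]mul1r ler_pM// (le_trans v1)// invf_le1// ler1n//.
  rewrite sumr_const card_ord -[_ *+ n]mulr_natl ler_pdivrMr// mul1r ler_nat//.
Qed.

Section ProductMeasureSections.
Context d1 d2 (T1 : measurableType d1) (T2 : measurableType d2) (R : realType).
Variable m1 : {sigma_finite_measure set T1 -> \bar R}.
Variable m2 : {sigma_finite_measure set T2 -> \bar R}.

Lemma eq_product_measure_xsection (D E : set (T1 * T2)) :
  (forall x, m2 (xsection D x) = m2 (xsection E x)) ->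
  (m1 \x m2)%E D = (m1 \x m2)%E E.
Proof. by move=> DE; apply: eq_integral => x _ /=; exact: DE. Qed.

(** The product measure is defined by integrating x-sections; on measurable sets, uniqueness
    identifies it with the integral of y-sections. *)
Lemma eq_product_measure_ysection (D E : set (T1 * T2)) :
  measurable D -> measurable E ->
  (forall y, m1 (ysection D y) = m1 (ysection E y)) ->
  (m1 \x m2)%E D = (m1 \x m2)%E E.
Proof.
move=> mD mE DE; have e A : measurable A -> (m1 \x m2)%E A = (m1 \x^ m2)%E A.
  by move=> mA; apply: product_measure_unique => //= *; rewrite product_measure2E.
by rewrite !e//; apply: eq_integral => y _ /=; exact: DE.
Qed.

End ProductMeasureSections.

Section OrthogonalInvariance.
Context {R : realType} {n : nat}.
Variable P : 'M[R]_n.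
Hypothesis PPt : P *m P^T = 1%:M.

Local Notation T := (rVborel R n).
Local Notation mu := (lebesgue_rV R n).
Local Notation rot := (fun v : T => (v : 'rV[R]_n) *m P : T).

Let mrot : measurable_fun setT rot.
Proof. by apply: measurable_rV_mulmx => //; exact: measurable_id. Qed.

(* Weil's argument for the uniqueness of Haar measure: both sides are the
   product measure of [{(x, y) | A (x P) /\ B y}], sheared to
   [{(x, y) | A (x P) /\ B (y + x P)}] and [{(x, y) | A (x P - y) /\ B (x P)}]. *)
Let exchange (A B : set T) : measurable A -> measurable B ->
  (mu (rot @^-1` A) * mu B = mu (rot @^-1` B) * mu A)%E.
Proof.
move=> mA mB.
have mx : measurable_fun setT (fun p : T * T => (p.1 : 'rV[R]_n) *m P : T).
  exact: (measurableT_comp mrot measurable_fst).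
have my : measurable_fun setT (fun p : T * T => p.2 : T) by exact: measurable_snd.
pose f1 (p : T * T) : T * T := (p.1 *m P, (p.2 : 'rV[R]_n) + p.1 *m P).
pose f2 (p : T * T) : T * T := (p.1 *m P - (p.2 : 'rV[R]_n), p.1 *m P).
have mf1 : measurable_fun setT f1.
  by apply/measurable_fun_pairP; split => //; exact: measurable_rV_add.
have mf2 : measurable_fun setT f2.
  apply/measurable_fun_pairP; split => //; apply: measurable_rV_add => //.
  exact: measurable_rV_opp.
have mAB : measurable (A `*` B) by exact: measurableX.
transitivity ((mu \x mu)%E (f1 @^-1` (A `*` B))).
  rewrite -product_measure1E//; last exact: measurable_preimage.
  apply: eq_product_measure_xsection => x.
  have [_ tr] := lebesgue_rV_translation ((x : 'rV[R]_n) *m P).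
  rewrite -tr; last first.
    by apply: measurable_xsection; apply: measurableX => //; exact: measurable_preimage.
  by congr (lebesgue_rV _ _ _).
transitivity ((mu \x mu)%E (f2 @^-1` (A `*` B))).
  (* For fixed [y], translating [x] by [- y P^T] turns [(x P, y + x P)] into [(x P - y, x P)], as
     [P^T P] is the identity. *)
  have mD1 := measurable_preimage mf1 mAB; have mD2 := measurable_preimage mf2 mAB.
  apply: eq_product_measure_ysection => // y.
  have [_ tr] := lebesgue_rV_translation (- ((y : 'rV[R]_n) *m P^T)).
  rewrite -[LHS]tr; last by exact: measurable_ysection.
  congr (lebesgue_rV _ _ _).
  have e (x : 'rV[R]_n) : (x - y *m P^T) *m P = x *m P - y.
    by rewrite mulmxBl -mulmxA (mulmx1C PPt) mulmx1.
  by apply/seteqP; split=> x; rewrite /ysection/= !in_setE /f1 /f2/= e [_ + (_ - _)]addrC subrK.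
rewrite -product_measure1E//; last exact: measurable_preimage.
(* For fixed [x], negating [y] and then translating by [x P] replaces [y] by [x P - y]. *)
apply: eq_product_measure_xsection => x; apply/esym.
have [mt tr] := lebesgue_rV_translation ((x : 'rV[R]_n) *m P).
have [mo op] := lebesgue_rV_opp R n.
have mB' : measurable (xsection ((rot @^-1` B) `*` A) x).
  apply: measurable_xsection; apply: measurableX => //; exact: measurable_preimage.
rewrite -tr// -op; last exact: measurable_preimage.
congr (lebesgue_rV _ _ _); apply/seteqP.
by split=> y; rewrite /xsection/= !in_setE/= [- _ + _]addrC => -[].
Qed.

(** Take for [B] in [exchange] the unit ball: [P] preserves it, and its measure, positive and
    finite, cancels. *)
Lemma lebesgue_rV_orthogonal : measure_preserving mu rot.
Proof.
split=> // A mA.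
have mB := @borel_closed_euclidean_ball R n 1.
have B0 := closed_euclidean_ball_gt0 R n.
have Boo := closed_euclidean_ball_lt_pinfty n (1 : R).
have := exchange mA mB.
have -> : rot @^-1` (closed_euclidean_ball 0 1) = closed_euclidean_ball 0 1.
  rewrite closed_euclidean_ball0E; apply/seteqP; split=> v /=;
    by rewrite euclidean_norm_orthogonal.
have Bfin : mu (closed_euclidean_ball 0 1) \is a fin_num.
  by rewrite ge0_fin_numE.
rewrite muleC => /eqP; rewrite eq_le !lee_pmul2l// -eq_le => /eqP.
exact.
Qed.

End OrthogonalInvariance.

(** * Random rotations *)

Section GramSchmidt.
Context {R : realType} {n : nat}.
Implicit Types X E K : 'M[R]_n.

(** The zero vector stays zero, so Gram-Schmidt is total. *)
Definition normalize (u : 'rV[R]_n) := (euclidean_norm u)^-1 *: u.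

(** When the nonzero rows of [E] are orthonormal, [E^T *m E] is the orthogonal projection onto their
    span. *)
Definition gs_residual X E i : 'rV[R]_n := row i X *m (1%:M - E^T *m E).

(* Row-wise Gram-Schmidt: the first [k] rows of [gram_schmidt X k] are the
   orthonormalised first [k] rows of [X], the others are zero. *)
Fixpoint gram_schmidt X k : 'M[R]_n :=
  if k is k'.+1 then
    let E := gram_schmidt X k' in
    \matrix_(i, j) if i == k' :> nat then normalize (gs_residual X E i) ord0 j
                   else E i j
  else 0.

Lemma row_gram_schmidtS X k i : row i (gram_schmidt X k.+1) =
  if i == k :> nat then normalize (gs_residual X (gram_schmidt X k) i)
  else row i (gram_schmidt X k).
Proof.
by apply/rowP => j; rewrite /= 2![LHS]mxE; case: ifP => // _; rewrite [RHS]mxE.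
Qed.

(** Gram-Schmidt uses only inner products of rows, which [K] preserves. This equivariance makes the
    random frame rotation invariant. *)
Lemma gram_schmidt_mulmx_orthogonal X K k : K *m K^T = 1%:M ->
  gram_schmidt (X *m K) k = gram_schmidt X k *m K.
Proof.
move=> KK; elim: k => [|k IH]; first by rewrite mul0mx.
apply/row_matrixP => i; rewrite row_mul !row_gram_schmidtS IH.
case: ifP => _; last by rewrite row_mul.
have -> : gs_residual (X *m K) (gram_schmidt X k *m K) i =
    gs_residual X (gram_schmidt X k) i *m K.
  rewrite /gs_residual row_mul !mulmxBr !mulmx1 mulmxBl; congr (_ - _).
  by rewrite trmx_mul !mulmxA -(mulmxA _ K) KK mulmx1.
by rewrite /normalize euclidean_norm_orthogonal// scalemxAl.
Qed.

Lemma row_gram_schmidt_ge X k (i : 'I_n) : (k <= i)%N ->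
  row i (gram_schmidt X k) = 0.
Proof.
elim: k => [|k IH] ki; first by rewrite raddf0.
by rewrite row_gram_schmidtS gtn_eqF// IH// ltnW.
Qed.

Lemma gram_schmidt_orthonormal X :
  (forall i : 'I_n, gs_residual X (gram_schmidt X i) i != 0) ->
  gram_schmidt X n *m (gram_schmidt X n)^T = 1%:M.
Proof.
move=> nz.
have dotE (A : 'M[R]_n) i j : (A *m A^T) i j = (row i A *m (row j A)^T) ord0 ord0.
  by rewrite !mxE; apply: eq_bigr => k _; rewrite !mxE.
suff gram k (i j : 'I_n) : (k <= n)%N ->
    (gram_schmidt X k *m (gram_schmidt X k)^T) i j = ((i == j) && (i < k)%N)%:R.
  by apply/matrixP => i j; rewrite gram// ltn_ord andbT !mxE.
elim: k i j => [|k IH] i j kn; first by rewrite mul0mx mxE ltn0 andbF.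
have kn' := ltnW kn.
set E := gram_schmidt X k in IH *.
(* The projection fixes the rows of [E], so the residual is orthogonal to all of them. *)
have ET : E^T *m E *m E^T = E^T.
  apply/matrixP => a b; rewrite -mulmxA mxE (bigD1 b)//= big1 ?addr0; last first.
    by move=> c cb; rewrite IH// (negbTE cb) mulr0.
  rewrite IH// eqxx/=; case: ltnP => [|kb]; first by rewrite mulr1.
  have : row b E ord0 a = 0 by rewrite row_gram_schmidt_ge// mxE.
  by rewrite mulr0 !mxE => ->.
have res_E a b : gs_residual X E a *m (row b E)^T = 0.
  rewrite tr_row colE /gs_residual mulmxA -(mulmxA (row a X)) mulmxBl mul1mx ET.
  by rewrite subrr mulmx0 mul0mx.
rewrite dotE !row_gram_schmidtS -/E.
case: (ltngtP i k) => [ik|ik|ik].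
- case: eqP => jk.
    rewrite -[X in X = _]/((row i E *m (normalize (gs_residual X E j))^T) ord0 ord0).
    rewrite -[_ *m _]trmxK trmx_mul trmxK /normalize -scalemxAl res_E scaler0.
    by rewrite !mxE; case: eqP => // ij; rewrite ij jk ltnn in ik.
  by rewrite -dotE IH// ik ltnS (ltnW ik).
- rewrite row_gram_schmidt_ge; last exact: ltnW.
  by rewrite mul0mx mxE ltnS leqNgt ik andbF.
- case: eqP => jk.
    have ij : i = j by apply: val_inj; rewrite /= ik jk.
    rewrite -ij eqxx ltnS ik leqnn /= /normalize linearZ/= -scalemxAl -scalemxAr scalerA mxE.
    rewrite -sqr_euclidean_norm -expr2 -exprMn mulVf ?expr1n//.
    apply: contra (nz i) => /eqP /euclidean_norm_eq0; rewrite /E ik => ->.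
    exact/eqP.
  rewrite /normalize -scalemxAl res_E scaler0 mxE.
  by case: eqP => // ij; case: jk; rewrite -ij.
Qed.

(** The rows of [gram_schmidt X i] are combinations of the rows of [X] before [i]. A zero residual
    would make row [i] such a combination too, against invertibility. *)
Lemma gs_residual_unitmx X (i : 'I_n) : X \in unitmx ->
  gs_residual X (gram_schmidt X i) i != 0.
Proof.
move=> Xu.
have [L [EL L0]] : exists L : 'M[R]_n, gram_schmidt X i = L *m X /\
    forall a b : 'I_n, (i <= b)%N -> L a b = 0.
  elim: (i : nat) => [|k [L [EL L0]]].
    by exists 0; split=> [|a b _]; rewrite ?mul0mx// mxE.
  (* [w a] holds the coefficients of the residual of row [a] in terms of the rows of [X], and [c a]
     is the normalising factor. *)
  pose w a : 'rV[R]_n := delta_mx ord0 a - row a X *m (gram_schmidt X k)^T *m L.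
  pose c a : R := (euclidean_norm (gs_residual X (gram_schmidt X k) a))^-1.
  exists (\matrix_(a, b) if a == k :> nat then c a * w a ord0 b else L a b).
  split=> [|a b kb]; last first.
    rewrite mxE; case: eqP => [ak|_]; last by rewrite L0// ltnW.
    have ba : b != a by apply: contraTneq kb => ->; rewrite ak ltnn.
    rewrite /w !mxE eqxx/= (negbTE ba) big1 ?subrr ?mulr0// => j _.
    by rewrite L0 ?mulr0// ltnW.
  apply/row_matrixP => a; rewrite row_gram_schmidtS row_mul.
  have -> : row a (\matrix_(a, b) if a == k :> nat then c a * w a ord0 b else L a b)
      = if a == k :> nat then c a *: w a else row a L.
    by apply/rowP => b; rewrite !mxE; case: ifP => _; rewrite !mxE.
  case: ifP => _; last by rewrite -row_mul -EL.
  rewrite /normalize -scalemxAl; congr (_ *: _).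
  rewrite /gs_residual /w mulmxBr mulmx1 mulmxBl -rowE; congr (_ - _).
  by rewrite [in X in _ *m (_ *m X) = _]EL !mulmxA.
apply/negP => /eqP.
rewrite /gs_residual mulmxBr mulmx1 [in X in _ *m (_ *m X)]EL !mulmxA.
rewrite [row i X]rowE -mulmxBl => /(congr1 (fun u => u *m invmx X)).
rewrite mul0mx mulmxK// -rowE => /(congr1 (fun u : 'rV[R]_n => u ord0 i)).
rewrite !mxE !eqxx/= big1 => [/eqP|j _]; last by rewrite L0// mulr0.
by rewrite subr0 oner_eq0.
Qed.

End GramSchmidt.

Section OrthogonalMaps.
Context {R : realType} {n : nat}.
Implicit Types u v w s : 'rV[R]_n.

Definition dot u v : R := (u *m v^T) ord0 ord0.

Lemma dotC u v : dot u v = dot v u.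
Proof. by rewrite /dot !mulmx_trE; apply: eq_bigr => i _; rewrite mulrC. Qed.

Lemma dotBl u v w : dot (u - v) w = dot u w - dot v w.
Proof. by rewrite /dot mulmxBl !mxE. Qed.

Lemma dotZl (a : R) u v : dot (a *: u) v = a * dot u v.
Proof. by rewrite /dot -scalemxAl mxE. Qed.

Lemma dotBr u v w : dot w (u - v) = dot w u - dot w v.
Proof. by rewrite !(dotC w) dotBl. Qed.

Lemma dotZr (a : R) u v : dot v (a *: u) = a * dot v u.
Proof. by rewrite !(dotC v) dotZl. Qed.

Lemma dot_norm u : dot u u = euclidean_norm u ^+ 2.
Proof. by rewrite sqr_euclidean_norm. Qed.

Lemma dot_eq0 u : (dot u u == 0) = (u == 0).
Proof.
rewrite dot_norm sqrf_eq0; apply/eqP/eqP => [/euclidean_norm_eq0//|->].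
by rewrite euclidean_normE mul0mx mxE sqrtr0.
Qed.

Lemma orthogonal_of_dot (P : 'M[R]_n) :
  (forall u v, dot (u *m P) (v *m P) = dot u v) -> P *m P^T = 1%:M.
Proof.
move=> dotP; apply/matrixP => i j.
have -> : (P *m P^T) i j = dot (row i P) (row j P).
  by rewrite /dot !mxE; apply: eq_bigr => k _; rewrite !mxE.
rewrite !rowE dotP /dot !mxE (bigD1 i)//= big1 => [|k ki].
  by rewrite !mxE !eqxx mul1r addr0.
by rewrite !mxE (negbTE ki) mul0r.
Qed.

(** Householder reflection in the hyperplane orthogonal to [s]; the identity for [s = 0]. *)
Definition reflection s : 'M[R]_n := 1%:M - (2 / dot s s) *: (s^T *m s).

Lemma mulmx_reflection u s :
  u *m reflection s = u - (2 * dot u s / dot s s) *: s.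
Proof.
rewrite /reflection mulmxBr mulmx1 -scalemxAr mulmxA; congr (_ - _).
rewrite [u *m s^T]mx11_scalar mul_scalar_mx scalerA -/(dot u s).
by rewrite mulrAC.
Qed.

Lemma reflection_orthogonal s : reflection s *m (reflection s)^T = 1%:M.
Proof.
apply: orthogonal_of_dot => u v; rewrite !mulmx_reflection.
have [->|s0] := eqVneq s 0; first by rewrite !scaler0 !subr0.
rewrite dotBl !dotBr !dotZl !dotZr (dotC s v).
by field; rewrite dot_eq0.
Qed.

(** For equal norms the squared norm of [u - v] is [2 * dot u (u - v)], so the reflection along
    [u - v] sends [u] to [v]. *)
Lemma exists_orthogonal u v : euclidean_norm u = euclidean_norm v ->
  exists2 K : 'M[R]_n, K *m K^T = 1%:M & u *m K = v.
Proof.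
move=> uv; have [->|u_neq_v] := eqVneq u v.
  by exists 1%:M; rewrite ?trmx1 mulmx1.
exists (reflection (u - v)); first exact: reflection_orthogonal.
rewrite mulmx_reflection; have : dot (u - v) (u - v) != 0.
  by rewrite dot_eq0 subr_eq0.
have -> : dot (u - v) (u - v) = 2 * dot u (u - v).
  by rewrite !dotBl !dotBr (dotC v u) !dot_norm uv; ring.
by move=> duv; rewrite divff// scale1r subKr.
Qed.

Lemma reflection_fixed u s : dot u s = 0 -> u *m reflection s = u.
Proof. by move=> us; rewrite mulmx_reflection us mulr0 mul0r scale0r subr0. Qed.

End OrthogonalMaps.

Section MeasurableGramSchmidt.
Context d (T : measurableType d) (R : realType) (n : nat).

Lemma measurable_normalize (f : T -> rVborel R n) : measurable_fun setT f ->
  measurable_fun setT (fun x => normalize (f x) : rVborel R n).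
Proof.
move=> mf; apply: measurable_fun_rV => i.
(* The inverse norm is written as the real power of exponent -1, a measurable function; both are 0
   at norm 0. *)
apply: (eq_measurable_fun (fun x =>
    euclidean_norm (f x : 'rV[R]_n) `^ (-1) * (f x : 'rV[R]_n) ord0 i)).
  by move=> x _; rewrite powR_inv1 ?euclidean_norm_ge0// mxE.
apply: measurable_funM; last exact: measurable_fun_rV_coord.
by apply: (measurableT_comp (measurable_powR _)); exact: measurable_euclidean_norm.
Qed.

Lemma measurable_gram_schmidt (X : T -> 'M[R]_n) k :
  (forall i j, measurable_fun setT (fun x => X x i j : measurableTypeR R)) ->
  forall i j, measurable_fun setT
    (fun x => gram_schmidt (X x) k i j : measurableTypeR R).
Proof.
move=> mX; elim: k => [|k IH] i j.
  apply: (eq_measurable_fun (fun=> 0 : measurableTypeR R)); last exact: measurable_cst.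
  by move=> x _; rewrite /= mxE.
pose E x := gram_schmidt (X x) k.
case: (eqVneq (i : nat) k) => ik; last first.
  apply: (eq_measurable_fun (fun x => E x i j)); last exact: IH.
  by move=> x _; rewrite /= mxE (negbTE ik).
apply: (eq_measurable_fun (fun x =>
    (normalize (gs_residual (X x) (E x) i) : 'rV[R]_n) ord0 j)).
  by move=> x _; rewrite /= mxE ik eqxx.
apply: measurable_fun_rV_coord; apply: measurable_normalize.
apply: measurable_rV_mulmx.
  apply: measurable_fun_rV => l.
  apply: (eq_measurable_fun (fun x => X x i l)); last exact: mX.
  by move=> x _; rewrite [RHS]mxE.
move=> a b; apply: (eq_measurable_fun (fun x =>
    (1%:M : 'M[R]_n) a b - \sum_c E x c a * E x c b)).
  move=> x _; rewrite [RHS]mxE; congr (_ + _); rewrite [RHS]mxE; congr (- _).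
  by rewrite [RHS]mxE; apply: eq_bigr => c _; rewrite mxE.
apply: measurable_funB; first exact: measurable_cst.
by apply: measurable_sum => c; apply: measurable_funM; exact: IH.
Qed.

End MeasurableGramSchmidt.

(** If [u *m X] vanishes, the coordinate of [u] of largest absolute value is at most [n * e] times
    itself in absolute value. *)
Lemma diagonally_dominant_unitmx (R : realType) n (X : 'M[R]_n) (e : R) :
  (forall i j, `|X i j - (i == j)%:R| <= e) -> n%:R * e < 1 -> X \in unitmx.
Proof.
move=> Xe ne; rewrite unitmxE unitfE; apply/negP => /det0P[u u0 uX].
have [i0 ui0] : exists i, u ord0 i != 0.
  apply/existsP; apply: contraNT u0; rewrite negb_exists => /forallP u0.
  by apply/eqP/rowP => i; rewrite mxE; apply/eqP; have := u0 i; rewrite negbK.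
pose j := [arg max_(i > i0) `|u ord0 i|]%O.
have ju i : `|u ord0 i| <= `|u ord0 j|.
  by rewrite /j; case: Order.TotalTheory.arg_maxP => // k _; exact.
have uj0 : 0 < `|u ord0 j| by rewrite (lt_le_trans _ (ju i0)) ?normr_gt0.
have ujE : u ord0 j = - \sum_i u ord0 i * (X i j - (i == j)%:R).
  have : (u *m X) ord0 j = 0 by rewrite uX mxE.
  rewrite mxE => uXj; under eq_bigr do rewrite mulrBr.
  rewrite sumrB uXj sub0r opprK (bigD1 j)//= eqxx mulr1 big1 ?addr0// => i ij.
  by rewrite (negbTE ij) mulr0.
have : `|u ord0 j| <= n%:R * e * `|u ord0 j|.
  rewrite {1}ujE normrN; apply: le_trans (ler_norm_sum _ _ _) _.
  apply: (@le_trans _ _ (\sum_(i < n) e * `|u ord0 j|)).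
    by apply: ler_sum => i _; rewrite normrM mulrC ler_pM.
  by rewrite sumr_const card_ord -[_ *+ n]mulr_natl mulrA.
by rewrite -[X in X <= _]mul1r ler_pM2r// leNgt ne.
Qed.

Section Frames.
Context {R : realType} {n : nat}.

(** Flattened matrices carry [lebesgue_rV]; restricted to [frames], this gives an unnormalised
    random orthogonal matrix. *)
Definition frame (u : 'rV[R]_(n * n)) : 'M[R]_n := gram_schmidt (vec_mx u) n.

(* The bound [n.*2] only serves to make the measure finite. *)
Definition frames : set (rVborel R (n * n)) :=
  [set u | frame u *m (frame u)^T = 1%:M] `&`
  closed_euclidean_ball (0 : 'rV[R]_(n * n)) n.*2%:R.

Lemma measurable_frame i j : measurable_fun setT
  (fun u : rVborel R (n * n) => frame u i j : measurableTypeR R).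
Proof.
apply: measurable_gram_schmidt => a b.
apply: (eq_measurable_fun (fun u : rVborel R (n * n) =>
    (u : 'rV[R]_(n * n)) ord0 (mxvec_index a b) : measurableTypeR R)).
  by move=> u _; rewrite mxE.
exact: measurable_rV_coord.
Qed.

Lemma measurable_frames : measurable frames.
Proof.
apply: measurableI; last exact: borel_closed_euclidean_ball.
rewrite (_ : [set _ | _] = \bigcap_(p in [set: 'I_n * 'I_n])
    ((fun u : rVborel R (n * n) => \sum_k frame u p.1 k * frame u p.2 k)
      @^-1` [set (p.1 == p.2)%:R])).
  apply: fin_bigcap_measurable => // p _.
  apply: measurable_preimage; last exact: measurable_set1.
  by apply: measurable_sum => k; apply: measurable_funM; exact: measurable_frame.
have e (A : 'M[R]_n) i j : (A *m A^T) i j = \sum_k A i k * A j k.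
  by rewrite mxE; apply: eq_bigr => k _; rewrite mxE.
apply/seteqP; split=> u /= Hu.
  by move=> [i j] _ /=; rewrite -e Hu mxE.
by apply/matrixP => i j; rewrite e mxE; exact: (Hu (i, j)).
Qed.

Lemma frames_lt_pinfty : (lebesgue_rV R (n * n) frames < +oo)%E.
Proof.
apply: le_lt_trans (closed_euclidean_ball_lt_pinfty (n * n) n.*2%:R).
apply: le_measure; rewrite ?inE; last by move=> u [].
  exact: measurable_frames.
exact: borel_closed_euclidean_ball.
Qed.

(** The box of radius [1 / (n + 1)] around the identity consists of invertible matrices by diagonal
    dominance. Their entries are at most 2 in absolute value, so the norm is at most [2 * n]. *)
Lemma frames_gt0 : (0 < lebesgue_rV R (n * n) frames)%E.
Proof.
pose c : 'rV[R]_(n * n) := mxvec 1%:M; pose e : R := n.+1%:R^-1.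
have e0 : 0 < e by rewrite invr_gt0.
have e1 : e <= 1 by rewrite invf_le1// ler1n.
apply: (@lebesgue_rV_box_gt0 _ _ _ (fun k => c ord0 k - e) (fun k => c ord0 k + e)).
- exact: measurable_frames.
- by move=> k; rewrite ltrBlDr -addrA ltrDl addr_gt0.
move=> u ub; have Xe i j : `|vec_mx u i j - (i == j)%:R| <= e.
  have := ub (mxvec_index i j); rewrite /c mxvecE !mxE => /andP[u1 u2].
  by rewrite ler_norml lerBrDr addrC u1 lerBlDr addrC u2.
have Xu : vec_mx u \in unitmx.
  apply: diagonally_dominant_unitmx Xe _.
  by rewrite ltr_pdivrMr// mul1r ltr_nat.
split; first by apply: gram_schmidt_orthonormal => i; exact: gs_residual_unitmx.
rewrite closed_euclidean_ball0E /= -[leRHS]ger0_norm// -sqrtr_sqr ler_wsqrtr//.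
apply: (@le_trans _ _ (\sum_(k < n * n) 4)).
  apply: ler_sum => k _; rewrite -[u]vec_mxK; case/mxvec_indexP: k => i j.
  rewrite mxvecE (_ : 4 = 2 ^+ 2); last by rewrite -natrX.
  rewrite -real_normK ?num_real// ler_pXn2r ?nnegrE//.
  rewrite -[X in `|X|](subrK (i == j)%:R); apply: le_trans (ler_normD _ _) _.
  rewrite (_ : 2 = 1 + 1)//; apply: lerD; first exact: le_trans (Xe i j) e1.
  by rewrite normr_nat lern1 leq_b1.
rewrite sumr_const card_ord -[4 *+ _]mulr_natr -natrM -natrX ler_nat; nia.
Qed.

Lemma dot_mxvec (A B : 'M[R]_n) : dot (mxvec A) (mxvec B) = \tr (A *m B^T).
Proof.
rewrite /dot mulmx_trE (reindex _ (curry_mxvec_bij _ _))/=.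
rewrite /mxtrace; under [RHS]eq_bigr do rewrite mxE.
rewrite pair_bigA /=; apply: eq_bigr => -[i j] _ /=.
by rewrite !mxvecE [in RHS]mxE.
Qed.

(** Right multiplication by [K] preserves the Frobenius product [dot_mxvec], hence is orthogonal on
    flattened matrices and preserves their Lebesgue measure; [frame] commutes with it. *)
Lemma frames_invariance (K : 'M[R]_n) (Z : set 'M[R]_n) : K *m K^T = 1%:M ->
  measurable ([set u | Z (frame u)] : set (rVborel R (n * n))) ->
  lebesgue_rV R (n * n) (frames `&` [set u | Z (frame u *m K)]) =
  lebesgue_rV R (n * n) (frames `&` [set u | Z (frame u)]).
Proof.
move=> KK mZ; pose P : 'M[R]_(n * n) := lin_mulmxr K.
have uP u : u *m P = mxvec (vec_mx u *m K) by rewrite mul_rV_lin.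
have PP : P *m P^T = 1%:M.
  apply: orthogonal_of_dot => u v; rewrite !uP dot_mxvec trmx_mul mulmxA.
  by rewrite -(mulmxA _ K) KK mulmx1 -dot_mxvec !vec_mxK.
have frameP u : frame (u *m P) = frame u *m K.
  by rewrite /frame uP mxvecK gram_schmidt_mulmx_orthogonal.
have [_ inv] := lebesgue_rV_orthogonal PP; rewrite -[RHS]inv; last first.
  by apply: measurableI; [exact: measurable_frames|exact: mZ].
congr (lebesgue_rV _ _ _); apply/seteqP.
suff e (u : 'rV[R]_(n * n)) : frames (u *m P) = frames u.
  by split=> u /=; rewrite e frameP.
rewrite /frames !closed_euclidean_ball0E /= frameP euclidean_norm_orthogonal//.
by rewrite trmx_mul mulmxA -(mulmxA _ K) KK mulmx1.
Qed.

End Frames.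

(** * Random cubes and sum-free sets *)

Section RandomPoints.
Context {R : realType} {d : nat}.
Variable S : set (rVborel R d).
Hypothesis mS : measurable S.
Implicit Types v w : 'rV[R]_d.

Local Notation B := (closed_euclidean_ball (0 : 'rV[R]_d) 1).
Local Notation mu := (lebesgue_rV R d \x lebesgue_rV R (d * d))%E.

(** The transpose turns right invariance of the frame into invariance under maps applied to [w]. *)
Definition random_point w (p : rVborel R d * rVborel R (d * d)) : rVborel R d :=
  (euclidean_norm (p.1 : 'rV[R]_d) *: w) *m (frame (p.2 : 'rV[R]_(d * d)))^T.

Definition hit w : set (rVborel R d * rVborel R (d * d)) :=
  (B `*` frames) `&` [set p | S (random_point w p)].

Let mframe_tr i j : measurable_fun setT
  (fun u : rVborel R (d * d) => (frame u)^T i j : measurableTypeR R).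
Proof.
apply: (eq_measurable_fun (fun u : rVborel R (d * d) =>
    frame u j i : measurableTypeR R)).
  by move=> u _; rewrite mxE.
exact: measurable_frame.
Qed.

Lemma measurable_random_point w : measurable_fun setT (random_point w).
Proof.
apply: measurable_rV_mulmx.
  apply: measurable_fun_rV => i.
  apply: (eq_measurable_fun
    (fun p : rVborel R d * rVborel R (d * d) => euclidean_norm p.1 * w ord0 i)).
    by move=> p _; rewrite mxE.
  apply: measurable_funM; last exact: measurable_cst.
  exact: (measurable_euclidean_norm measurable_fst).
by move=> i j; apply: (measurableT_comp (mframe_tr i j) measurable_snd).
Qed.

Lemma measurable_ball_frames :
  measurable (B `*` frames : set (rVborel R d * rVborel R (d * d))).
Proof.
apply: measurableX; last exact: measurable_frames.
exact: borel_closed_euclidean_ball.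
Qed.

Lemma measurable_hit w : measurable (hit w).
Proof.
apply: measurableI; first exact: measurable_ball_frames.
by apply: measurable_preimage mS; exact: measurable_random_point.
Qed.

Let msection v : measurable
  ([set u | S (v *m (frame u)^T)] : set (rVborel R (d * d))).
Proof.
apply: (measurable_preimage (f := fun u : rVborel R (d * d) =>
  v *m (frame u)^T : rVborel R d)) mS.
by apply: measurable_rV_mulmx => //; exact: measurable_cst.
Qed.

(** For fixed [x], replacing the frame by its product with [K^T] preserves the measure and, after
    transposition, puts [K] next to both [v] and [w]. *)
Lemma hit_setI_orthogonal v w (K : 'M[R]_d) : K *m K^T = 1%:M ->
  mu (hit v `&` hit w) = mu (hit (v *m K) `&` hit (w *m K)).
Proof.
move=> KK; apply: eq_product_measure_xsection => x.
pose r := euclidean_norm (x : 'rV[R]_d).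
pose Z (M : 'M[R]_d) := S ((r *: v) *m M^T) /\ S ((r *: w) *m M^T).
have [Bx|Bx] := pselect (B x); last first.
  by congr (lebesgue_rV _ _ _); apply/seteqP; split=> u;
    rewrite /xsection/= !in_setE => -[[[/= /Bx]]].
have mZ : measurable ([set u | Z (frame u)] : set (rVborel R (d * d))).
  exact: (measurableI _ _ (msection (r *: v)) (msection (r *: w))).
have Kt : K^T *m K^T^T = 1%:M by rewrite trmxK (mulmx1C KK).
transitivity (lebesgue_rV R (d * d) (frames `&` [set u | Z (frame u)])).
  by congr (lebesgue_rV _ _ _); apply/seteqP; split=> u;
    rewrite /xsection/= !in_setE /hit /Z/=; tauto.
rewrite -(frames_invariance Kt mZ); congr (lebesgue_rV _ _ _).
apply/seteqP; split=> u;
  rewrite /xsection/= !in_setE /hit /Z/= /random_point/= trmx_mul trmxK;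
  rewrite !scalemxAl !mulmxA; tauto.
Qed.

(* A reflection turns [|x| w] into [x], which removes [w]; then rotating [x]
   preserves Lebesgue measure on the ball. *)
Lemma hit_unit w : euclidean_norm w = 1 ->
  mu (hit w) = (lebesgue_rV R d (S `&` B) * lebesgue_rV R (d * d) frames)%E.
Proof.
move=> w1.
have mSB : measurable (S `&` B) by apply: measurableI => //; exact: borel_closed_euclidean_ball.
pose C : set (rVborel R d * rVborel R (d * d)) :=
  (B `*` frames) `&` [set p | S ((p.1 : 'rV[R]_d) *m (frame p.2)^T)].
have mC : measurable C.
  apply: measurableI; first exact: measurable_ball_frames.
  apply: (measurable_preimage (f := fun p : rVborel R d * rVborel R (d * d) =>
    (p.1 : 'rV[R]_d) *m (frame p.2)^T : rVborel R d)) mS.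
  apply: measurable_rV_mulmx; first exact: measurable_fst.
  by move=> i j; apply: (measurableT_comp (mframe_tr i j) measurable_snd).
transitivity (mu C).
  apply: eq_product_measure_xsection => x.
  pose r := euclidean_norm (x : 'rV[R]_d).
  have [Bx|Bx] := pselect (B x); last first.
    by congr (lebesgue_rV _ _ _); apply/seteqP; split=> u;
      rewrite /xsection/= !in_setE => -[[/= /Bx]].
  have [|K KK wK] := @exists_orthogonal R d (r *: w) x.
    by rewrite euclidean_normZ ?euclidean_norm_ge0// w1 mulr1.
  have Kt : K^T *m K^T^T = 1%:M by rewrite trmxK (mulmx1C KK).
  transitivity (lebesgue_rV R (d * d)
      (frames `&` [set u | S ((r *: w) *m (frame u)^T)])).
    by congr (lebesgue_rV _ _ _); apply/seteqP; split=> u;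
      rewrite /xsection/= !in_setE /hit/=; tauto.
  rewrite -(frames_invariance (Z := fun M => S ((r *: w) *m M^T)) Kt)//.
  by congr (lebesgue_rV _ _ _); apply/seteqP; split=> u;
    rewrite /xsection/= !in_setE /C/= trmx_mul trmxK mulmxA wK; tauto.
have mSBf : measurable ((S `&` B) `*` frames : set (rVborel R d * rVborel R (d * d))).
  by apply: measurableX => //; exact: measurable_frames.
rewrite -product_measure1E//; last exact: measurable_frames.
apply: eq_product_measure_ysection => // u.
have [fu|fu] := pselect (frames u); last first.
  by congr (lebesgue_rV _ _ _); apply/seteqP; split=> x;
    rewrite /ysection/= !in_setE => -[[]] //= [].
have O : (frame u)^T *m (frame u)^T^T = 1%:M.
  by case: fu => /= [/mulmx1C]; rewrite trmxK.
have [_ inv] := lebesgue_rV_orthogonal O; rewrite -[RHS]inv; last exact: measurable_ysection.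
congr (lebesgue_rV _ _ _); apply/seteqP.
split=> x; rewrite /ysection/= !in_setE /C closed_euclidean_ball0E/=;
  rewrite euclidean_norm_orthogonal//; tauto.
Qed.

Lemma sum_free_hit v w : sum_free S ->
  euclidean_norm v = 1 -> euclidean_norm w = 1 -> dot v w = 2^-1 ->
  (mu (hit v `&` hit w) + mu (hit v `&` hit (- w)%R) <= mu (hit v))%E.
Proof.
move=> sfS v1 w1 vw.
have vv : dot v v = 1 by rewrite dot_norm v1 expr1n.
have ww : dot w w = 1 by rewrite dot_norm w1 expr1n.
(* The reflection along [2 w - v] fixes [v] and exchanges [w - v] and [- w]. *)
pose s := 2%:R *: w - v; pose K := reflection s.
have ss : dot s s = 3 by rewrite /s !(dotBl, dotBr, dotZl, dotZr) vv ww (dotC w v) vw; field.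
have vs : dot v s = 0 by rewrite /s !(dotBl, dotBr, dotZl, dotZr) vv vw; field.
have zK : (w - v) *m K = - w.
  rewrite mulmx_reflection ss.
  have -> : dot (w - v) s = 3 / 2.
    by rewrite /s !(dotBl, dotBr, dotZl, dotZr) vv ww (dotC w v) vw; field.
  have -> : 2 * (3 / 2) / 3 = 1 :> R by field.
  by rewrite scale1r /s scaler_nat mulr2n opprB addrA subrK opprD addrA subrr sub0r.
rewrite -{2}(reflection_fixed vs) -zK -hit_setI_orthogonal ?reflection_orthogonal//.
have mvw := measurableI _ _ (measurable_hit v) (measurable_hit w).
have mvz := measurableI _ _ (measurable_hit v) (measurable_hit (w - v)).
(* The two events are disjoint: at a common point, the images of [v] and [w - v] would add up to
   that of [w], all three in [S]. *)
rewrite -measureU//; last first.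
  rewrite -subset0 => p [[[_ Sv] [_ Sw]] [_ [_ Sz]]]; apply: sfS.
  exists (random_point v p), (random_point (w - v) p), (random_point w p).
  by split=> //; rewrite /random_point -mulmxDl -scalerDr addrC subrK.
apply: le_measure; rewrite ?inE; [exact: measurableU|exact: measurable_hit|].
by move=> p [|] [].
Qed.

End RandomPoints.

(** * Averaging the cube inequality *)

Section HasIntegral.
Context d (T : measurableType d) (R : realType) (mu : {measure set T -> \bar R}).

(** Carrying integrability together with a finite value keeps linear combinations in [R]. *)
Definition has_integral (f : T -> R) (a : R) :=
  mu.-integrable setT (EFin \o f) /\ (\int[mu]_x (f x)%:E = a%:E)%E.

Lemma has_integral_indic A a : measurable A -> mu A = a%:E ->
  has_integral \1_A a.
Proof.
move=> mA muA; split; last by rewrite integral_indic// setIT.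
apply/integrableP; split; first exact/measurable_EFinP.
rewrite (eq_integral (fun x => (\1_A x)%:E)); last first.
  by move=> x _; rewrite gee0_abs// lee_fin.
by rewrite integral_indic// setIT muA ltry.
Qed.

Lemma has_integralZ c f a : has_integral f a ->
  has_integral (fun x => c * f x) (c * a).
Proof.
move=> [intf fa]; split; first exact: (integrableZl _ c intf).
by rewrite (integralZl _ intf) // fa.
Qed.

Lemma has_integralD f g a b : has_integral f a -> has_integral g b ->
  has_integral (fun x => f x + g x) (a + b).
Proof.
move=> [intf fa] [intg gb]; split; first exact: (integrableD _ intf intg).
by rewrite (integralD_EFin _ intf intg) //= fa gb.
Qed.

Lemma has_integral_sum (I : Type) (s : seq I) (P : pred I) (f : I -> T -> R) a :
  (forall i, P i -> has_integral (f i) (a i)) ->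
  has_integral (fun x => \sum_(i <- s | P i) f i x) (\sum_(i <- s | P i) a i).
Proof.
move=> fa; elim: s => [|i s IH].
  rewrite big_nil (_ : (fun _ => _) = \1_set0).
    by apply: has_integral_indic => //; rewrite measure0.
  by apply/funext => x; rewrite big_nil indic0.
rewrite big_cons (_ : (fun _ => _) = fun x =>
    if P i then f i x + \sum_(i <- s | P i) f i x else \sum_(i <- s | P i) f i x).
  by case: (boolP (P i)) => // Pi; apply: has_integralD => //; exact: fa.
by apply/funext => x; rewrite big_cons.
Qed.

Lemma has_integral_ge0 f a : has_integral f a -> (forall x, 0 <= f x) -> 0 <= a.
Proof.
by move=> [_ fa] f0; rewrite -lee_fin -fa integral_ge0// => x _; rewrite lee_fin.
Qed.

End HasIntegral.

Section SumFreeCube.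
Context d (T : measurableType d) (R : realType) (mu : {measure set T -> \bar R}).
Variables (D : set T) (m k : nat) (E : {ffun 'I_m -> bool} -> set T) (t a e : R).
Hypotheses (mD : measurable D) (muD : mu D = t%:E) (t0 : 0 < t).
Hypotheses (mE : forall A, measurable (E A)) (ED : forall A, E A `<=` D).
Hypotheses (muE : forall A, mu (E A) = a%:E).
Hypothesis E_sum_free : forall A B, weight B = k ->
  (mu (E A `&` E (cube_add A B)) + mu (E A `&` E (cube_opp (cube_add A B)))
    <= a%:E)%E.
Hypotheses (km : (k <= m)%N) (e0 : 0 <= e).
Hypothesis krawtchouk_ge : forall B : {ffun 'I_m -> bool},
  - (e * 'C(m, k)%:R) <= krawtchouk k B.

(** Integrating [h_ge0] and bounding the pair terms by [E_sum_free] gives a quadratic inequality for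
    the density [q]. *)
Lemma measure_cube_le : a <= (2^-1 + e) * t.
Proof.
have a0 : 0 <= a by rewrite -lee_fin -(muE [ffun=> false]) measure_ge0.
pose N : R := (2 ^ m)%:R; pose C : R := 'C(m, k)%:R; pose q := a / t.
have N0 : 0 < N by rewrite ltr0n expn_gt0.
have C0 : 0 < C by rewrite ltr0n bin_gt0.
pose b A B := fine (mu (E A `&` E B)).
have Eb A B : mu (E A `&` E B) = (b A B)%:E.
  rewrite fineK// ge0_fin_numE// (@le_lt_trans _ _ (mu (E A)))//.
    by apply: le_measure; rewrite ?inE//; exact: measurableI.
  by rewrite muE ltry.
have b_le A B : weight B = k -> b A (cube_add A B) + b A (cube_opp (cube_add A B)) <= a.
  by move=> wB; rewrite -lee_fin EFinD -!Eb E_sum_free.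
pose W x : R := \sum_A \sum_(B | weight B == k)
  (\1_(E A `&` E (cube_add A B)) x + \1_(E A `&` E (cube_opp (cube_add A B))) x).
pose s x : R := \sum_A \1_(E A) x.
(* [convolution_ge] with [(s x)^2] bounded below by its tangent at the mean [N q],
   which makes it linear in the events. *)
have h_ge0 x : 0 <= N * W x +
    ((2 * e * C * N - 4 * C * N * q) * s x + 2 * C * N ^+ 2 * q ^+ 2 * \1_D x).
  have [Dx|Dx] := pselect (D x); last first.
    have E0 A : \1_(E A) x = 0 :> R.
      by rewrite indicE memNset// => /ED.
    have -> : s x = 0 by rewrite /s big1.
    have -> : W x = 0.
      by rewrite /W big1// => A _; rewrite big1// => B _; rewrite !indicI/= !E0 !mul0r addr0.
    by rewrite indicE memNset// !mulr0 !addr0.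
  have := convolution_ge (fun A => \1_(E A) x : R) e0 (k := k).
  rewrite krawtchouk0 => /(_ krawtchouk_ge); rewrite -/C -/N.
  (* Indicators are idempotent, so the error term is linear in the events as well. *)
  have -> : \sum_A \1_(E A) x ^+ 2 = s x.
    apply: eq_bigr => A _; rewrite indicE; case: (_ \in _); by rewrite ?expr1n ?expr0n.
  have -> : \sum_A \sum_(B | weight B == k) (\1_(E A) x * \1_(E (cube_add A B)) x +
      \1_(E A) x * \1_(E (cube_opp (cube_add A B))) x) = W x.
    by apply: eq_bigr => A _; apply: eq_bigr => B _; rewrite !indicI.
  rewrite -/(s x) indicE mem_set// mulr1.
  have := mulr_ge0 (ltW C0) (sqr_ge0 (s x - N * q)); lra.
pose w := \sum_A \sum_(B : {ffun 'I_m -> bool} | weight B == k)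
  (b A (cube_add A B) + b A (cube_opp (cube_add A B))).
have card_cube : #|{ffun 'I_m -> bool}|%:R = N.
  by rewrite card_ffun card_bool card_ord.
have w_le : w <= N * (C * a).
  rewrite /w; apply: (@le_trans _ _ (\sum_(A : {ffun 'I_m -> bool}) C * a)).
    apply: ler_sum => A _; rewrite /C -card_weight mulr_natl -sumr_const.
    by apply: ler_sum => B /eqP wB; exact: b_le.
  by rewrite sumr_const -mulr_natl card_cube.
have : 0 <= N * w +
    ((2 * e * C * N - 4 * C * N * q) * (N * a) + 2 * C * N ^+ 2 * q ^+ 2 * t).
  apply: has_integral_ge0 h_ge0; apply: has_integralD.
    apply: has_integralZ; apply: has_integral_sum => A _.
    apply: has_integral_sum => B _.
    by apply: has_integralD; apply: has_integral_indic => //; exact: measurableI.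
  apply: has_integralD; apply: has_integralZ; last exact: has_integral_indic.
  rewrite -card_cube mulr_natl -sumr_const; apply: has_integral_sum => A _.
  exact: has_integral_indic.
have qt : q * t = a by rewrite /q divfK ?gt_eqF.
have := ler_wpM2l (ltW N0) w_le.
rewrite -qt => Nw h; have {Nw h} : 0 <= N ^+ 2 * C * t * (q * (1 + 2 * e - 2 * q)) by nra.
(* What remains is [0 <= q * (1 + 2 * e - 2 * q)], so [q] is nonpositive or at most [2^-1 + e]. *)
rewrite pmulr_rge0 ?mulr_gt0 ?exprn_gt0// => q_le.
rewrite ler_pM2r//; have [q0|q0] := leP q 0.
  by apply: le_trans q0 _; rewrite addr_ge0 ?invr_ge0.
by move: q_le; rewrite pmulr_rge0//; lra.
Qed.

End SumFreeCube.

(** * The cube in Euclidean space and the choice of constants *)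

Section CubeVectors.
Context {R : realType} {m d : nat}.
Hypotheses (m0 : (0 < m)%N) (md : (m <= d)%N).
Implicit Types A B : {ffun 'I_m -> bool}.

Definition cube_vector A : 'rV[R]_d :=
  (\row_i ((-1) ^+ A i / Num.sqrt m%:R) : 'rV[R]_m) *m pid_mx m.

(** Each coordinate contributes [1 / m], with a minus sign where [B] flips it. For
    [weight B = m / 4] the value is one half. *)
Lemma dot_cube_vector A B :
  dot (cube_vector A) (cube_vector (cube_add A B)) =
  (m%:R - (weight B).*2%:R) / m%:R.
Proof.
rewrite /dot /cube_vector trmx_mul mulmxA -(mulmxA _ (pid_mx m)) tr_pid_mx.
rewrite mul_pid_mx minnn (minn_idPr md) pid_mx_1 mulmx1 mulmx_trE.
under eq_bigr => i _.
  rewrite !mxE ffunE mulrACA -signr_addb addKb.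
  rewrite -invfM -expr2 sqr_sqrtr ?ler0n//.
  over.
rewrite -mulr_suml; congr (_ / _).
under eq_bigr do rewrite signrE.
rewrite sumrB sumr_const card_ord; congr (_ - _).
rewrite -natr_sum -mul2n /weight big_distrr; congr (_%:R).
by apply: eq_bigr => i _; rewrite -mul2n.
Qed.

Lemma euclidean_norm_cube_vector A : euclidean_norm (cube_vector A) = 1.
Proof.
have : dot (cube_vector A) (cube_vector A) = 1.
  have {2}-> : A = cube_add A [ffun=> false].
    by apply/ffunP => i; rewrite !ffunE addbF.
  rewrite dot_cube_vector /weight big1 ?subr0 ?divff ?pnatr_eq0 -?lt0n// => i _.
  by rewrite ffunE.
by rewrite euclidean_normE -/(dot _ _) => ->; rewrite sqrtr1.
Qed.

Lemma cube_vector_opp A : cube_vector (cube_opp A) = - cube_vector A.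
Proof.
rewrite /cube_vector -mulNmx; congr (_ *m _); apply/rowP => i; rewrite !mxE ffunE.
by rewrite signrN mulNr.
Qed.

End CubeVectors.

(** The base [3 ^ 12 / 2 ^ 20] times [2 ^ 18 / 3 ^ 11] is [3 / 4], which is at most [expR (- 4^-1)].
    The second factor exceeds 1.47, and its [p]-th power absorbs [16 * p + 1] from [p = 16] on. *)
Lemma krawtchouk_error_le (R : realType) p : (16 <= p)%N ->
  (16 * p).+1%:R * (3 ^+ 12 / 2 ^+ 20) ^+ p <= expR (- (p%:R / 8)) ^+ 2 :> R.
Proof.
move=> p16; have -> : expR (- (p%:R / 8)) ^+ 2 = expR (- 4^-1) ^+ p :> R.
  by rewrite -!expRM_natl; congr expR; field.
have e34 : 3 / 4 <= expR (- 4^-1) :> R by apply: le_trans (expR_ge1Dx _); lra.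
apply: (@le_trans _ _ ((3 / 4) ^+ p)); last by rewrite lerXn2r ?nnegrE ?expR_ge0//; lra.
have -> : 3 / 4 = 3 ^+ 12 / 2 ^+ 20 * (2 ^+ 18 / 3 ^+ 11) :> R by field.
rewrite [leRHS]exprMn [leRHS]mulrC ler_wpM2r//.
have r0 : 147 / 100 <= 2 ^+ 18 / 3 ^+ 11 :> R by lra.
apply: (@le_trans _ _ ((147 / 100) ^+ p)); last by rewrite lerXn2r ?nnegrE//; lra.
rewrite -(subnK p16); elim: (p - 16)%N => [|q IH].
  by rewrite add0n; lra.
rewrite addSn exprS.
apply: le_trans (_ : 147 / 100 * (16 * (q + 16)).+1%:R <= _); last first.
  by rewrite ler_wpM2l//; lra.
have E n : (16 * n).+1%:R = 16 * n%:R + 1 :> R by rewrite -natr1 natrM.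
by have := ler0n R q; rewrite !E -addnS !natrD; lra.
Qed.

Theorem proposition1p3 (R : realType) :
  exists (c : R) (d0 : nat), 0 < c /\
    forall d : nat, (d0 <= d)%N ->
      (sigma (closed_euclidean_ball (0 : 'rV[R]_d) 1)
        <= (2^-1 + expR (- c * d%:R))%:E)%E.
Proof.
(* With [p = d %/ 16], the bound [d >= 256] gives [p >= 16], and [d <= 32 * p] turns the error
   [expR (- (p / 8))] into [expR (- (d / 256))]. *)
exists 256^-1, 256%N; split=> [|d d256]; first by rewrite invr_gt0.
apply: ge_ereal_sup => _ [S [mS sfS] <-].
pose p := (d %/ 16)%N; pose m := (16 * p)%N; pose e : R := expR (- (p%:R / 8)).
have p16 : (16 <= p)%N by rewrite leq_divRL.
have m0 : (0 < m)%N by rewrite /m; lia.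
have md : (m <= d)%N by rewrite /m mulnC leq_trunc_div.
pose B := closed_euclidean_ball (0 : 'rV[R]_d) 1.
pose mu := (lebesgue_rV R d \x lebesgue_rV R (d * d))%E.
have fin A : (A < +oo)%E -> (0 <= A)%E -> (fine A)%:E = A :> \bar R.
  by move=> Aoo A0; rewrite fineK// ge0_fin_numE.
have [Boo B0] := (closed_euclidean_ball_lt_pinfty d (1 : R), closed_euclidean_ball_gt0 R d).
have [Foo F0] := (@frames_lt_pinfty R d, @frames_gt0 R d).
have mB := @borel_closed_euclidean_ball R d 1.
have SBoo : (lebesgue_rV R d (S `&` B) < +oo)%E.
  apply: le_lt_trans Boo; apply: le_measure; rewrite ?inE; last exact: subIsetr.
    exact: (measurableI _ _ mS mB).
  exact: mB.
pose b := fine (lebesgue_rV R d B); pose f := fine (lebesgue_rV R (d * d) (@frames R d)).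
pose s := fine (lebesgue_rV R d (S `&` B)).
have bE : lebesgue_rV R d B = b%:E by rewrite fin// ltW.
have fE : lebesgue_rV R (d * d) (@frames R d) = f%:E by rewrite fin// ltW.
have sE : lebesgue_rV R d (S `&` B) = s%:E by rewrite fin.
have b0 : 0 < b by rewrite -lte_fin -bE.
have f0 : 0 < f by rewrite -lte_fin -fE.
have v1 (A : {ffun 'I_m -> bool}) : euclidean_norm (cube_vector A : 'rV[R]_d) = 1.
  exact: euclidean_norm_cube_vector.
have mu_hit (A : {ffun 'I_m -> bool}) : mu (hit S (cube_vector A)) = (s * f)%:E.
  by rewrite EFinM -sE -fE; exact: (hit_unit mS (v1 A)).
(* The measures are not normalised: the whole space has mass [b * f] and each event mass [s * f],
   and [f] cancels afterwards. *)
have : s * f <= (2^-1 + e) * (b * f).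
  apply: (@measure_cube_le _ _ _ mu (B `*` @frames R d) m (4 * p)
    (fun A => hit S (cube_vector A))).
  - exact: measurable_ball_frames.
  - transitivity (lebesgue_rV R d B * lebesgue_rV R (d * d) (@frames R d))%E.
      exact: (product_measure1E _ _ mB (@measurable_frames R d)).
    by rewrite bE fE.
  - by rewrite mulr_gt0.
  - by move=> A; exact: measurable_hit.
  - by move=> A; exact: subIsetl.
  - exact: mu_hit.
  - move=> A D wD; rewrite cube_vector_opp.
    rewrite -(mu_hit A); apply: (sum_free_hit mS sfS (v1 _) (v1 _)).
    rewrite dot_cube_vector// wD /m -mul2n mulnA -[(2 * 4)%N]/8%N !natrM.
    by field; apply: lt0r_neq0; rewrite ltr0n; exact: leq_trans p16.
  - by rewrite leq_mul2r orbT.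
  - exact: expR_ge0.
  - by move=> A; apply: krawtchouk_ge; [exact: expR_ge0|exact: krawtchouk_error_le].
rewrite mulrA ler_pM2r// => sb.
rewrite /uniform_measure -/B sE bE inver gt_eqF// -EFinM lee_fin ler_pdivrMr//.
apply: le_trans sb _; rewrite ler_pM2r// lerD2l ler_expR.
have : (d < 16 * p.+1)%N by rewrite mulnC -ltn_divLR.
(* Since [p >= 1], the bound [d < 16 * p.+1] is absorbed by doubling. *)
have : (d <= 32 * p)%N by lia.
rewrite -(ler_nat R) natrM; lra.
Qed.
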